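(* Let $M$ be a manifold, $E$ an oriented vector bundle over $M$ of rank $4n$, $h$ a neutral metric of $E$, and $\nabla$ an $h$-connection of $E$ (a connection with $\nabla h=0$). Let $I$ be a complex structure of $E$ and $J_1,J_2$ paracomplex structures of $E$ such that $I,J_1,J_2$ give a paraquaternionic structure $E_{I,J_1,J_2}$ to which $h$ is adapted. Then the following hold: (a) for $r\in\mathbb{R}\setminus\{0\}$ and $\theta\in[0,2\pi)$, the section of $E_{I,J_1,J_2}$ given by $N_{r,\theta}:=r(I-(\sin\theta)J_1+(\cos\theta)J_2)$ is an $H$-nilpotent structure of $(E,h)$; (b) if $h,\nabla,I,J_1,J_2$ form a neutral hyperK\''{a}hler structure of $E$, then $N_{r,\theta}$ (for $r\in\mathbb{R}\setminus\{0\}$, $\theta\in[0,2\pi)$) is an $H$-nilpotent structure of $(E,h,\nabla)$.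
   Context: Everything is smooth. $h$ neutral means that $h$ is a bundle metric of signature $(2n,2n)$. An ordered pseudo-orthonormal local frame field $e=(e_1,\dots,e_{4n})$ of $(E,h)$ always has $e_1,\dots,e_{2n}$ space-like ($h(e_i,e_i)=1$) and $e_{2n+1},\dots,e_{4n}$ time-like ($h(e_i,e_i)=-1$). For $\varepsilon\in\{+,-\}$ set $I_{1,\pm}:=\pm1$ and $I_{n,\pm}:={\rm diag}(\pm1,1,\dots,1)$ ($n\times n$) for $n\ge2$; $I'_{4n,\varepsilon}:={\rm diag}(I_n,I_n,I_n,I_{n,\varepsilon})$ (block diagonal), and $$\Lambda_n:=\left[\begin{array}{cccc}O_n&-I_n&O_n&I_n\\ I_n&O_n&I_n&O_n\\ O_n&I_n&O_n&-I_n\\ I_n&O_n&I_n&O_n\end{array}\right],$$ with $I_n$, $O_n$ the $n\times n$ unit and zero matrices. A section $N$ of ${\rm End}\,E$ is an $\varepsilon$-nilpotent structure of $(E,h)$ if on a neighborhood of each point of $M$ there is an ordered pseudo-orthonormal local frame field $e$ of $(E,h)$ giving the orientation of $E$ with $NeI'_{4n,\varepsilon}=eI'_{4n,\varepsilon}\Lambda_n$ (frames are treated as row vectors); such an $e$ is called an admissible frame field of $N$. For a Lie subgroup $K$ of $SO(2n,2n)$, an $\varepsilon$-nilpotent structure $N$ of $(E,h)$ ($\varepsilon=+$ or $-$) is called a $K$-nilpotent structure of $(E,h)$ if there exist an open cover $\{U_\lambda\}_{\lambda\in\Lambda}$ of $M$ and a family $\{e_\lambda\}_{\lambda\in\Lambda}$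 of admissible frame fields of $N$ such that (i) each $e_\lambda$ is defined on $U_\lambda$; (ii) if $U_\lambda\cap U_\mu\ne\emptyset$, then $e_\mu I'_{4n,\varepsilon}=e_\lambda I'_{4n,\varepsilon}A_{\lambda\mu}$ on $U_\lambda\cap U_\mu$ for a function $A_{\lambda\mu}$ valued in $K$. It is called a $K$-nilpotent structure of $(E,h,\nabla)$ if these can be chosen so that, in addition, (iii) the connection form $\omega_\lambda$ of $\nabla$ with respect to $e_\lambda I'_{4n,\varepsilon}$, defined by $\nabla(e_\lambda I'_{4n,\varepsilon})=e_\lambda I'_{4n,\varepsilon}\omega_\lambda$, is valued in the Lie algebra of $K$. $H$ is the Lie subgroup of $SO(2n,2n)$ consisting of all elements of $SO(2n,2n)$ of the form (with $n\times n$ blocks) $$\left[\begin{array}{cccc}A_{11}&-A_{21}&A_{31}&A_{41}\\ A_{21}&A_{11}&-A_{41}&A_{31}\\ A_{31}&-A_{41}&A_{11}&A_{21}\\ A_{41}&A_{31}&-A_{21}&A_{11}\end{array}\right].$$ A complex structure $I$ of $E$ is a section of ${\rm End}\,E$ with $I^2=-{\rm id}$; a paracomplex structure $J$ of $E$ is a section of ${\rm End}\,E$ with $J^2={\rm id}$ whose $\pm1$-eigenbundles have equal rank. $I,J_1,J_2$ give a paraquaternionic structure $E_{I,J_1,J_2}$ if (i) $IJ_1=J_2$ and $I,J_1,J_2$ span a subbundle $E_{I,J_1,J_2}$ of ${\rm End}\,E$ of rank $3$. $h$ is adapted to $E_{I,J_1,J_2}$ if (ii) $I$ preserves $h$ ($h(I\cdot,I\cdot)=h$)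 and $J_1,J_2$ reverse $h$ ($h(J_k\cdot,J_k\cdot)=-h$). $h,\nabla,I,J_1,J_2$ form a neutral hyperK\''{a}hler structure of $E$ if (i), (ii) hold and (iii) $\nabla I=0$, $\nabla J_1=0$, $\nabla J_2=0$.
   Formalization: The manifold M is assumed connected: on a disconnected M, reversing the orientation of E on one component forces different signs ε on different components, so no single ε works and (a) fails as stated. *)

(* Defs.v *)
From HB Require Import structures.
From mathcomp Require Import all_boot all_order all_algebra.
From mathcomp Require Import all_classical all_reals all_analysis.
Set Implicit Arguments.
Unset Strict Implicit.
Unset Printing Implicit Defensive.
Import Order.TTheory GRing.Theory Num.Theory.
Import numFieldNormedType.Exports.
Local Open Scope classical_set_scope.
Local Open Scope ring_scope.

(* Functions and sections that are only relevant on an open set U are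
   represented by total functions; every condition below only looks at their
   restriction to U. *)

(** * Smooth manifolds *)

Section Euclidean.
Context {R : realType} {m : nat}.

(* All partial derivatives of order <= k exist and are continuous on the open
   set U. *)
Fixpoint Ck (k : nat) (U : set 'rV[R]_m) (f : 'rV[R]_m -> R) : Prop :=
  (forall x, U x -> {for x, continuous f}) /\
  if k is k'.+1 then
    forall i : 'I_m,
      (forall x, U x -> derivable f x (delta_mx 0 i)) /\
      Ck k' U (fun x => 'D_(delta_mx 0 i) f x)
  else True.

Definition Cinf (U : set 'rV[R]_m) (f : 'rV[R]_m -> R) := forall k, Ck k U f.

End Euclidean.

(* [chart_inv i] is the inverse of [chart_map i] : chart_dom i -> R^m; it is
   arbitrary outside [chart_map i @` chart_dom i]. *)
Record manifold (R : realType) (m : nat) := Manifold {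
  manifold_sort :> topologicalType;
  manifold_hausdorff : hausdorff_space manifold_sort;
  manifold_second_countable : @second_countable manifold_sort;
  chart_idx : Type;
  chart_dom : chart_idx -> set manifold_sort;
  chart_map : chart_idx -> manifold_sort -> 'rV[R]_m;
  chart_inv : chart_idx -> 'rV[R]_m -> manifold_sort;
  chart_cover : forall x, exists i, chart_dom i x;
  chart_dom_open : forall i, open (chart_dom i);
  chart_img_open : forall i, open (chart_map i @` chart_dom i);
  chart_mapK : forall i x, chart_dom i x -> chart_inv i (chart_map i x) = x;
  chart_map_cont : forall i x, chart_dom i x ->
    {for x, continuous (chart_map i)};
  chart_inv_cont : forall i y, (chart_map i @` chart_dom i) y ->
    {for y, continuous (chart_inv i)};
  chart_smooth : forall i j (l : 'I_m),
    Cinf (chart_map i @` (chart_dom i `&` chart_dom j))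
         (fun y => chart_map j (chart_inv i y) 0 l)
}.

Section Manifold.
Context {R : realType} {m : nat} {M : manifold R m}.

Definition smooth_fun (U : set M) (f : M -> R) :=
  forall i : chart_idx M,
    Cinf (chart_map i @` (U `&` chart_dom i)) (f \o chart_inv i).

Definition smooth_fun_at (x : M) (f : M -> R) :=
  exists U : set M, [/\ open U, U x & smooth_fun U f].

(* Tangent vectors at x are derivations of the algebra of germs at x of smooth
   functions.  The germ invariance follows from the Leibniz rule applied to
   indicator functions of neighbourhoods of x.  Functions that are not smooth
   near x get the junk value 0, so that a tangent vector is determined by the
   derivation. *)
Record tangent (x : M) := Tangent {
  tangent_der :> (M -> R) -> R;
  tangent_linear : forall a f g, smooth_fun_at x f -> smooth_fun_at x g ->
    tangent_der (fun y => a * f y + g y) = a * tangent_der f + tangent_der g;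
  tangent_leibniz : forall f g, smooth_fun_at x f -> smooth_fun_at x g ->
    tangent_der (fun y => f y * g y) =
      tangent_der f * g x + f x * tangent_der g;
  tangent_junk : forall f, ~ smooth_fun_at x f -> tangent_der f = 0
}.

Definition smooth_vector_field (U : set M) (X : forall x, tangent x) :=
  forall (V : set M) (f : M -> R), open V -> V `<=` U -> smooth_fun V f ->
    smooth_fun V (fun x => X x f).

End Manifold.

(** * Vector bundles *)

(* A vector bundle given by its fibres and an atlas of local frames (i.e. of
   local trivializations) with smooth transition functions. *)
Record bundle (R : realType) (m : nat) (M : manifold R m) (k : nat) := Bundle {
  fiber :> M -> vectType R;
  triv_idx : Type;
  triv_dom : triv_idx -> set M;
  triv_frame : triv_idx -> forall x, k.-tuple (fiber x);
  triv_cover : forall x, exists i, triv_dom i x;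
  triv_dom_open : forall i, open (triv_dom i);
  triv_basis : forall i x, triv_dom i x -> basis_of fullv (triv_frame i x);
  triv_smooth : forall i j (a b : 'I_k),
    smooth_fun (triv_dom i `&` triv_dom j)
      (fun x => coord (triv_frame i x) a (tnth (triv_frame j x) b))
}.

Section Bundle.
Context {R : realType} {m : nat} {M : manifold R m} {k : nat}.
Variable E : bundle M k.

Definition section := forall x, E x.
Definition endo_section := forall x, 'End(E x).
Definition frame_field := forall x, k.-tuple (E x).

Definition smooth_section (U : set M) (s : section) :=
  forall (i : triv_idx E) (a : 'I_k),
    smooth_fun (U `&` triv_dom i) (fun x => coord (triv_frame i x) a (s x)).

Definition smooth_section_at (x : M) (s : section) :=
  exists U : set M, [/\ open U, U x & smooth_section U s].

Definition smooth_endo (A : endo_section) :=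
  forall (i : triv_idx E) (a b : 'I_k),
    smooth_fun (triv_dom i)
      (fun x => coord (triv_frame i x) a (A x (tnth (triv_frame i x) b))).

Definition local_frame (U : set M) (e : frame_field) :=
  (forall x, U x -> basis_of fullv (e x)) /\
  (forall j : 'I_k, smooth_section U (fun x => tnth (e x) j)).

(* [pos x e]: the basis e of the fibre at x is positively oriented. *)
Record orientation := Orientation {
  pos : forall x : M, set (k.-tuple (E x));
  pos_basis : forall x e, @pos x e -> basis_of fullv e;
  pos_change : forall (x : M) (e e' : k.-tuple (E x)),
    @pos x e -> basis_of fullv e' ->
    (@pos x e' <-> 0 < \det (\matrix_(a, b) coord e a (tnth e' b)));
  pos_local : forall x : M, exists (U : set M) (e : frame_field),
    [/\ open U, U x, local_frame U e & forall y, U y -> @pos y (e y)]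
}.

(* [nabla x v s] is the covariant derivative at x of the local section s (a
   section smooth near x) in the direction of the tangent vector v at x.
   Linearity in v is expressed through any w that equals a u + v as a
   derivation; locality in s follows from the Leibniz rule applied to
   indicator functions of neighbourhoods of x. *)
Record connection := Connection {
  nabla :> forall x : M, tangent x -> section -> E x;
  nabla_tangent_linear : forall (x : M) (a : R) (u v w : tangent x) s,
    smooth_section_at x s -> (forall f, w f = a * u f + v f) ->
    nabla w s = a *: nabla u s + nabla v s;
  nabla_add : forall (x : M) (v : tangent x) (s t : section),
    smooth_section_at x s -> smooth_section_at x t ->
    nabla v (fun y => s y + t y) = nabla v s + nabla v t;
  nabla_leibniz : forall (x : M) (v : tangent x) (f : M -> R) (s : section),
    smooth_fun_at x f -> smooth_section_at x s ->
    nabla v (fun y => f y *: s y) = v f *: s x + f x *: nabla v s;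
  nabla_smooth : forall (U : set M) (X : forall x, tangent x) (s : section),
    open U -> smooth_vector_field U X -> smooth_section U s ->
    smooth_section U (fun x => nabla (X x) s)
}.

(* The covariant derivative (nabla_v A)(s) for the induced connection of
   End E. *)
Definition nabla_endo (D : connection) (A : endo_section)
    (x : M) (v : tangent x) (s : section) : E x :=
  D x v (fun y => A y (s y)) - A x (D x v s).

Definition parallel (D : connection) (A : endo_section) :=
  forall (x : M) (v : tangent x) (s : section),
    smooth_section_at x s -> nabla_endo D A v s = 0.

Definition is_complex_structure (I : endo_section) :=
  smooth_endo I /\ forall x, (I x \o I x)%VF = - \1%VF.

Definition is_paracomplex_structure (J : endo_section) :=
  smooth_endo J /\
  forall x, (J x \o J x)%VF = \1%VF /\
    \dim (passmx.leigenspace (J x) 1) = \dim (passmx.leigenspace (J x) (-1)).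

Definition is_paraquaternionic (I J1 J2 : endo_section) :=
  forall x, (I x \o J1 x)%VF = J2 x /\
    \dim <<[:: I x; J1 x; J2 x]>>%VS = 3%N.

End Bundle.

(* The row vector e A, for e regarded as a row vector of fibre elements. *)
Definition frame_mul (R : realType) (V : vectType R) (k l : nat)
    (e : k.-tuple V) (A : 'M[R]_(k, l)) : l.-tuple V :=
  [tuple \sum_i A i j *: tnth e i | j < l].

(** * Matrices *)

(* 4n, bracketed so that 4n x 4n matrices are 2 x 2 blocks of 2 x 2 blocks. *)
Notation fourn n := ((n + n) + (n + n))%N.

Section Matrices.
Context {R : realType} (n : nat).

Definition neutral_mx : 'M[R]_(fourn n) := block_mx 1%:M 0 0 (- 1%:M).

(* In what follows the sign epsilon is a boolean: [false] is +, [true] is -. *)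
Definition In_eps (eps : bool) : 'M[R]_n :=
  diag_mx (\row_(i < n) if val i == 0%N then (-1) ^+ eps else 1).

Definition I'4n (eps : bool) : 'M[R]_(fourn n) :=
  block_mx 1%:M 0 0 (block_mx 1%:M 0 0 (In_eps eps)).

Definition Lambda_mx : 'M[R]_(fourn n) :=
  block_mx (block_mx 0 (- 1%:M) 1%:M 0) (block_mx 0 1%:M    1%:M 0)
           (block_mx 0 1%:M     1%:M 0) (block_mx 0 (- 1%:M) 1%:M 0).

Definition SO_neutral : set 'M[R]_(fourn n) :=
  [set A | A^T *m neutral_mx *m A = neutral_mx /\ \det A = 1].

Definition H_group : set 'M[R]_(fourn n) :=
  [set A | SO_neutral A /\ exists A11 A21 A31 A41 : 'M[R]_n,
    A = block_mx
      (block_mx A11 (- A21) A21 A11)  (block_mx A31 A41 (- A41) A31)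
      (block_mx A31 (- A41) A41 A31)  (block_mx A11 A21 (- A21) A11)].

End Matrices.
Arguments SO_neutral {R} n.
Arguments H_group {R} n.

(* The Lie algebra of a matrix Lie group K: velocities at the identity of the
   smooth curves in K. *)
Definition lie_algebra (R : realType) (k : nat) (K : set 'M[R]_k)
    : set 'M[R]_k :=
  [set X | exists (c : R -> 'M[R]_k) (d : R),
    [/\ 0 < d, c 0 = 1%:M,
        forall t, `|t| < d -> K (c t),
        forall t (q : nat) i j, `|t| < d ->
          derivable (derive1n q (fun u => c u i j)) t 1
      & forall i j, derive1 (fun u => c u i j) 0 = X i j]].

(** * Neutral metrics and nilpotent structures *)

Record neutral_metric (R : realType) (m : nat) (M : manifold R m) (n : nat)
    (E : bundle M (fourn n)) := NeutralMetric {
  metric :> forall x : M, E x -> E x -> R;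
  metric_linear : forall x v, scalar (fun u => @metric x u v);
  metric_sym : forall x u v, @metric x u v = @metric x v u;
  metric_smooth : forall (i : triv_idx E) (a b : 'I_(fourn n)),
    smooth_fun (triv_dom i) (fun x =>
      @metric x (tnth (triv_frame i x) a) (tnth (triv_frame i x) b));
  metric_signature : forall x, exists e : (fourn n).-tuple (E x),
    basis_of fullv e /\
    forall a b, @metric x (tnth e a) (tnth e b) = neutral_mx n a b
}.

Section Neutral.
Context {R : realType} {m : nat} {M : manifold R m} {n : nat}.
Context {E : bundle M (fourn n)}.
Variables (o : orientation E) (h : neutral_metric E).

Definition metric_connection (D : connection E) :=
  forall (x : M) (v : tangent x) (s t : section E),
    smooth_section_at x s -> smooth_section_at x t ->
    v (fun y => h y (s y) (t y)) = h x (D x v s) (t x) + h x (s x) (D x v t).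

Definition preserves (A : endo_section E) :=
  forall x u v, h x (A x u) (A x v) = h x u v.

Definition reverses (A : endo_section E) :=
  forall x u v, h x (A x u) (A x v) = - h x u v.

Definition adapted (I J1 J2 : endo_section E) :=
  [/\ preserves I, reverses J1 & reverses J2].

Definition neutral_hyperkahler (D : connection E) (I J1 J2 : endo_section E) :=
  [/\ is_paraquaternionic I J1 J2, adapted I J1 J2,
      parallel D I, parallel D J1 & parallel D J2].

Definition pseudo_orthonormal (U : set M) (e : frame_field E) :=
  local_frame U e /\
  forall x, U x -> forall a b,
    h x (tnth (e x) a) (tnth (e x) b) = neutral_mx n a b.

(* The frame field e I'_{4n,eps}. *)
Definition twist (eps : bool) (e : frame_field E) : frame_field E :=
  fun x => frame_mul (e x) (I'4n n eps).

Definition admissible (eps : bool) (N : endo_section E) (U : set M)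
    (e : frame_field E) :=
  [/\ pseudo_orthonormal U e,
      forall x, U x -> pos o (e x)
    & forall x, U x -> map_tuple (N x) (twist eps e x) =
                       frame_mul (twist eps e x) (Lambda_mx n)].

Definition eps_nilpotent (eps : bool) (N : endo_section E) :=
  smooth_endo N /\
  forall x : M, exists (U : set M) (e : frame_field E),
    [/\ open U, U x & admissible eps N U e].

Definition K_family (K : set 'M[R]_(fourn n)) (eps : bool)
    (N : endo_section E) (L : Type) (U : L -> set M)
    (e : L -> frame_field E) :=
  [/\ forall l, open (U l),
      forall x, exists l, U l x,
      forall l, admissible eps N (U l) (e l)
    & forall l l', exists A : M -> 'M[R]_(fourn n),
        forall x, U l x -> U l' x ->
          K (A x) /\ twist eps (e l') x = frame_mul (twist eps (e l) x) (A x)].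


(* The connection form of D with respect to the frame field f on U, i.e.
   nabla f = f omega. *)
Definition is_connection_form (D : connection E) (U : set M)
    (f : frame_field E) (omega : forall x : M, tangent x -> 'M[R]_(fourn n)) :=
  forall (x : M) (v : tangent x), U x ->
    [tuple D x v (fun y => tnth (f y) j) | j < fourn n] =
    frame_mul (f x) (omega x v).

(* K is meant to be a Lie subgroup of SO(2n,2n). *)
Definition K_nilpotent (K : set 'M[R]_(fourn n)) (N : endo_section E) :=
  exists eps, eps_nilpotent eps N /\
    exists (L : Type) (U : L -> set M) (e : L -> frame_field E),
      K_family K eps N U e.

Definition K_nilpotent_connection (K : set 'M[R]_(fourn n))
    (D : connection E) (N : endo_section E) :=
  exists eps, eps_nilpotent eps N /\
    exists (L : Type) (U : L -> set M) (e : L -> frame_field E),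
      K_family K eps N U e /\
      forall l, exists omega,
        is_connection_form D (U l) (twist eps (e l)) omega /\
        forall (x : M) (v : tangent x), U l x ->
          lie_algebra K (omega x v).

End Neutral.

(* Main.v *)
Require Import Defs.
From mathcomp Require Import all_boot all_order all_algebra.
From mathcomp Require Import all_classical all_reals all_analysis.
From mathcomp Require Import ring lra zify.
Set Implicit Arguments.
Unset Strict Implicit.
Unset Printing Implicit Defensive.
Import Order.TTheory GRing.Theory Num.Theory.
Import numFieldNormedType.Exports.
Local Open Scope classical_set_scope.
Local Open Scope ring_scope.

(** The paraquaternionic structure may be changed without changing the problem.
    Put J1' = cos theta J1 + sin theta J2 and J2' = I J1', so that N_{r,theta} is
    r (I + J2'), and then I' = a I + b J2' with a + b = r and a^2 - b^2 = 1.  The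
    pair I', J1' again satisfies the paraquaternionic relations, is adapted to h,
    is parallel if the given structure is, and N_{r,theta} = I' + I' J1'
    ([para_hermitian_change]).  It thus suffices to treat N = I + I J.

    A frame of the form f = (u, I u, J u, I J u), with u orthonormal over the
    paraquaternions, is pseudo-orthonormal, and I, J act on it through constant
    matrices [LI], [LJ] with LI + LI LJ = Lambda.  Such frames exist near each
    point by a Gram-Schmidt process over the paraquaternions
    ([local_adapted_frame]).  The block pattern of H expresses commutation with
    [LI] and [LJ], and an isometry with this pattern has determinant 1 because
    the determinant of such a pattern is a square ([H_form_det_ge0]).  Hence the
    transition matrices between adapted frames lie in H, all adapted frames at a
    point have the same orientation, and on a connected manifold one sign eps
    makes all frames f I'_{4n,eps} positive ([exists_orientation_sign]); these
    are the admissible frames.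

    If h, I and J are parallel, the connection form of an adapted frame is skew
    for the neutral form and commutes with [LI] and [LJ].  Such a matrix is the
    velocity of a curve in H, namely the curve of its Cayley transforms
    ([lie_algebra_H]). *)

(** * Smooth functions on open subsets of Euclidean space *)

Lemma continuous_at_near_eq (T S : topologicalType) (f g : T -> S) x :
  {near x, f =1 g} -> {for x, continuous f} -> {for x, continuous g}.
Proof.
move=> fg; rewrite /prop_for /continuous_at (nbhs_singleton fg).
by apply: cvg_trans; apply: near_eq_cvg.
Qed.

Section CkCalculus.
Context {R : realType} {m : nat}.
Implicit Types (U : set 'rV[R]_m) (f g : 'rV[R]_m -> R).

Lemma Ck_continuous k U f : Ck k U f -> forall x, U x -> {for x, continuous f}.
Proof. by case: k => [|k] []. Qed.

Lemma Ck_pred k U f : Ck k.+1 U f -> Ck k U f.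
Proof.
elim: k f => [|k IH] f [cf df]; first by split.
by split=> // i; have [? /IH] := df i.
Qed.

Lemma Ck_eq k U f g : open U -> (forall x, U x -> f x = g x) ->
  Ck k U f -> Ck k U g.
Proof.
move=> oU; have nfg (f' g' : 'rV[R]_m -> R) : (forall x, U x -> f' x = g' x) ->
    forall x, U x -> {near x, f' =1 g'}.
  move=> fg' x Ux; have := open_nbhs_nbhs (conj oU Ux : open_nbhs x U).
  by apply: filterS => y; apply: fg'.
elim: k f g => [|k IH] f g fg [cf df]; (split; first by
  move=> x Ux; apply: continuous_at_near_eq (nfg _ _ fg x Ux) (cf x Ux)) => //.
move=> i; have [dfi Dfi] := df i; split.
  by move=> x Ux; apply: near_eq_derivable (dfi x Ux); exact: (nfg f g fg x Ux).
by apply: IH Dfi => x Ux; apply: near_eq_derive; exact: (nfg f g fg x Ux).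
Qed.

Lemma Ck_bigcup k (T : Type) (U : T -> set 'rV[R]_m) f :
  (forall t, Ck k (U t) f) -> Ck k (\bigcup_t U t) f.
Proof.
elim: k f => [|k IH] f Hf; (split; [move=> x [t _ Utx]|]; first
  exact: (Ck_continuous (Hf t) Utx)) => //.
move=> i; split; first by move=> x [t _ Utx]; have [_ /(_ i) [+ _]] := Hf t; apply.
by apply: IH => t; have [_ /(_ i) []] := Hf t.
Qed.

Lemma Ck_sub k U V f : V `<=` U -> Ck k U f -> Ck k V f.
Proof.
move=> VU; elim: k f => [|k IH] f [cf df].
  by split=> // x /VU; apply: cf.
split; first by move=> x /VU; apply: cf.
by move=> i; have [dfi Dfi] := df i; split; [move=> x /VU; apply: dfi|apply: IH].
Qed.

Lemma Ck_cst k U (a : R) : Ck k U (fun=> a).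
Proof.
elim: k a => [|k IH] a; (split; first by move=> x _; exact: cst_continuous) => //.
move=> i; split; first by move=> x _; apply: derivable_cst.
have := IH 0; congr (Ck k U _).
by apply/funext => x; rewrite derive_cst.
Qed.

Lemma Ck_add k U f g : open U -> Ck k U f -> Ck k U g ->
  Ck k U (fun x => f x + g x).
Proof.
move=> oU; elim: k f g => [|k IH] f g [cf df] [cg dg];
  (split; first by move=> x Ux; exact: (cvgD (cf x Ux) (cg x Ux))) => //.
move=> i; have [df1 df2] := df i; have [dg1 dg2] := dg i; split.
  by move=> x Ux; apply: derivableD; [exact: df1|exact: dg1].
apply: Ck_eq (IH _ _ df2 dg2) => // x Ux.
by rewrite -deriveD //; [exact: df1|exact: dg1].
Qed.

Lemma Ck_mul k U f g : open U -> Ck k U f -> Ck k U g ->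
  Ck k U (fun x => f x * g x).
Proof.
move=> oU; elim: k f g => [|k IH] f g Cf Cg; case: (Cf) (Cg) => cf df [cg dg];
  (split; first by move=> x Ux; exact: (cvgM (cf x Ux) (cg x Ux))) => //.
move=> i; have [df1 df2] := df i; have [dg1 dg2] := dg i; split.
  by move=> x Ux; apply: derivableM; [exact: df1|exact: dg1].
apply: Ck_eq (Ck_add oU (IH _ _ (Ck_pred Cf) dg2)
                        (IH _ _ (Ck_pred Cg) df2)) => // x Ux.
by rewrite [RHS]deriveM //; [exact: df1|exact: dg1].
Qed.

Lemma Ck_inv k U f : open U -> (forall x, U x -> f x != 0) -> Ck k U f ->
  Ck k U (fun x => (f x)^-1).
Proof.
move=> oU f0; elim: k => [|k IH] Cf; case: (Cf) => cf df;
  (split; first by move=> x Ux; exact: (cvgV (f0 x Ux) (cf x Ux))) => //.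
move=> i; have [df1 df2] := df i; split.
  by move=> x Ux; apply: derivableV; [exact: f0|exact: df1].
have Cfi := IH (Ck_pred Cf).
apply: Ck_eq (Ck_mul oU (Ck_mul oU (Ck_cst k U (-1)) (Ck_mul oU Cfi Cfi)) df2)
  => // x Ux.
rewrite deriveV; [|exact: f0|exact: df1].
by rewrite expr2 invfM mulN1r.
Qed.

End CkCalculus.

(** * Smooth functions and sections *)

Section SmoothFunctions.
Context {R : realType} {m : nat} {M : manifold R m}.
Implicit Types (U V : set M) (f g : M -> R).

Lemma open_chart_image i U : open U ->
  open (chart_map i @` (U `&` @chart_dom _ _ M i)).
Proof.
move=> oU; rewrite openE => y [x [Ux dx] xy].
have iy : (chart_map i @` @chart_dom _ _ M i) y by exists x.
have ny := open_nbhs_nbhs (conj (@chart_img_open _ _ M i) iy : open_nbhs y _).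
have UD : nbhs (chart_inv i y) (U `&` @chart_dom _ _ M i).
  rewrite -xy chart_mapK //; apply: open_nbhs_nbhs; split=> //.
  by apply: openI => //; exact: chart_dom_open.
have := chart_inv_cont iy UD; move: ny; rewrite /interior.
apply: filterS2 => z [x' dx' <-] /=; rewrite chart_mapK // => -[Ux' _].
by exists x'.
Qed.

Lemma smooth_fun_eq U f g : open U -> (forall x, U x -> f x = g x) ->
  smooth_fun U f -> smooth_fun U g.
Proof.
move=> oU fg sf i k; apply: Ck_eq (sf i k); first exact: open_chart_image.
by move=> _ [x [Ux dx] <-] /=; rewrite chart_mapK // fg.
Qed.

Lemma smooth_fun_sub U V f : V `<=` U -> smooth_fun U f -> smooth_fun V f.
Proof.
move=> VU sf i k; apply: Ck_sub (sf i k).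
by apply: image_subset; apply: setSI.
Qed.

Lemma smooth_fun_cover (T : Type) (V : T -> set M) U f :
  U `<=` \bigcup_t V t -> (forall t, smooth_fun (U `&` V t) f) ->
  smooth_fun U f.
Proof.
move=> UV sf i k; apply: Ck_sub (Ck_bigcup (fun t => sf t i k)).
move=> _ [x [Ux dx] <-]; have [t _ Vtx] := UV x Ux.
by exists t => //; exists x.
Qed.

Lemma smooth_fun_cst U (a : R) : smooth_fun U (fun=> a).
Proof. by move=> i k; apply: Ck_cst. Qed.

Lemma smooth_fun_add U f g : open U -> smooth_fun U f -> smooth_fun U g ->
  smooth_fun U (fun x => f x + g x).
Proof.
move=> oU sf sg i k; apply: Ck_add (sf i k) (sg i k); exact: open_chart_image.
Qed.

Lemma smooth_fun_mul U f g : open U -> smooth_fun U f -> smooth_fun U g ->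
  smooth_fun U (fun x => f x * g x).
Proof.
move=> oU sf sg i k; apply: Ck_mul (sf i k) (sg i k); exact: open_chart_image.
Qed.

Lemma smooth_fun_inv U f : open U -> (forall x, U x -> f x != 0) ->
  smooth_fun U f -> smooth_fun U (fun x => (f x)^-1).
Proof.
move=> oU f0 sf i k; apply: Ck_inv (sf i k); first exact: open_chart_image.
by move=> _ [x [Ux dx] <-] /=; rewrite chart_mapK // f0.
Qed.

Lemma smooth_fun_sum (J : Type) (r : seq J) (F : J -> M -> R) U : open U ->
  (forall j, smooth_fun U (F j)) -> smooth_fun U (fun x => \sum_(j <- r) F j x).
Proof.
move=> oU sF; elim: r => [|j r IH].
  by apply: smooth_fun_eq (smooth_fun_cst U 0) => // x _; rewrite big_nil.
apply: smooth_fun_eq (smooth_fun_add oU (sF j) IH) => // x _.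
by rewrite big_cons.
Qed.

Lemma smooth_fun_opp U f : open U -> smooth_fun U f ->
  smooth_fun U (fun x => - f x).
Proof.
move=> oU sf; apply: smooth_fun_eq (smooth_fun_mul oU (smooth_fun_cst U (-1)) sf)
  => // x _; by rewrite mulN1r.
Qed.

Lemma smooth_fun_prod (T : Type) (r : seq T) (F : T -> M -> R) U : open U ->
  (forall j, smooth_fun U (F j)) -> smooth_fun U (fun x => \prod_(j <- r) F j x).
Proof.
move=> oU sF; elim: r => [|j r IH].
  by apply: smooth_fun_eq (smooth_fun_cst U 1) => // x _; rewrite big_nil.
apply: smooth_fun_eq (smooth_fun_mul oU (sF j) IH) => // x _.
by rewrite big_cons.
Qed.

Lemma smooth_fun_det k (A : M -> 'M[R]_k) U : open U ->
  (forall i j, smooth_fun U (fun x => A x i j)) ->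
  smooth_fun U (fun x => \det (A x)).
Proof.
move=> oU sA; apply: smooth_fun_sum => // s; apply: smooth_fun_mul => //.
  exact: smooth_fun_cst.
exact: smooth_fun_prod.
Qed.

Lemma smooth_fun_continuous U f x : open U -> smooth_fun U f -> U x ->
  {for x, continuous f}.
Proof.
move=> oU sf Ux; have [i dx] := chart_cover x.
have Ix : (chart_map i @` (U `&` @chart_dom _ _ M i)) (chart_map i x).
  by exists x.
have cfi := Ck_continuous (sf i 0%N) Ix.
have := continuous_comp (chart_map_cont dx) cfi.
apply: continuous_at_near_eq.
have : open_nbhs x (@chart_dom _ _ M i) by split=> //; apply: chart_dom_open.
by move/open_nbhs_nbhs; apply: filterS => y dy /=; rewrite chart_mapK.
Qed.

End SmoothFunctions.

Section SmoothSections.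
Context {R : realType} {m : nat} {M : manifold R m} {k : nat}.
Context {E : bundle M k}.
Implicit Types (U V : set M) (s t : section E).

Lemma smooth_section_eq U s t : open U -> (forall x, U x -> s x = t x) ->
  smooth_section U s -> smooth_section U t.
Proof.
move=> oU st ss i a; apply: smooth_fun_eq (ss i a).
  by apply: openI => //; exact: triv_dom_open.
by move=> x [Ux _]; rewrite st.
Qed.

Lemma smooth_section_sub U V s : V `<=` U ->
  smooth_section U s -> smooth_section V s.
Proof. by move=> VU ss i a; apply: smooth_fun_sub (ss i a); apply: setSI. Qed.

Lemma smooth_section_zero U : open U -> smooth_section U (fun x => 0 : E x).
Proof.
move=> oU i a; have oUi : open (U `&` @triv_dom _ _ _ _ E i).
  by apply: openI => //; exact: triv_dom_open.
by apply: smooth_fun_eq (smooth_fun_cst _ 0) => // x _; rewrite linear0.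
Qed.

Lemma smooth_section_add U s t : open U ->
  smooth_section U s -> smooth_section U t ->
  smooth_section U (fun x => s x + t x).
Proof.
move=> oU ss st i a; have oUi : open (U `&` @triv_dom _ _ _ _ E i).
  by apply: openI => //; exact: triv_dom_open.
apply: smooth_fun_eq (smooth_fun_add oUi (ss i a) (st i a)) => // x _.
by rewrite linearD.
Qed.

Lemma smooth_section_scale U (f : M -> R) s : open U ->
  smooth_fun U f -> smooth_section U s -> smooth_section U (fun x => f x *: s x).
Proof.
move=> oU sf ss i a; have oUi : open (U `&` @triv_dom _ _ _ _ E i).
  by apply: openI => //; exact: triv_dom_open.
have sf' := smooth_fun_sub (@subIsetl _ U (@triv_dom _ _ _ _ E i)) sf.
apply: smooth_fun_eq (smooth_fun_mul oUi sf' (ss i a)) => // x _.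
by rewrite linearZ.
Qed.

Lemma smooth_section_opp U s : open U -> smooth_section U s ->
  smooth_section U (fun x => - s x).
Proof.
move=> oU ss; apply: smooth_section_eq
  (smooth_section_scale oU (smooth_fun_cst U (-1)) ss) => // x _.
by rewrite scaleN1r.
Qed.

Lemma smooth_section_sum (J : Type) (r : seq J) (S : J -> section E) U :
  open U -> (forall j, smooth_section U (S j)) ->
  smooth_section U (fun x => \sum_(j <- r) S j x).
Proof.
move=> oU sS; elim: r => [|j r IH].
  by apply: smooth_section_eq (smooth_section_zero oU) => // x _;
    rewrite big_nil.
apply: smooth_section_eq (smooth_section_add oU (sS j) IH) => // x _.
by rewrite big_cons.
Qed.

Lemma smooth_section_endo U (A : endo_section E) s : open U ->
  smooth_endo A -> smooth_section U s -> smooth_section U (fun x => A x (s x)).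
Proof.
move=> oU sA ss i a; have oUi : open (U `&` @triv_dom _ _ _ _ E i).
  by apply: openI => //; exact: triv_dom_open.
have sA' b := smooth_fun_sub (@subIsetr _ U (@triv_dom _ _ _ _ E i)) (sA i a b).
have := smooth_fun_sum (index_enum 'I_k) oUi
          (fun b => smooth_fun_mul oUi (ss i b) (sA' b)).
apply: smooth_fun_eq => // x [_ dx].
have bx : s x \in <<triv_frame i x>>%VS.
  by rewrite (span_basis (triv_basis dx)) memvf.
rewrite {2}(coord_span bx) !linear_sum; apply: eq_bigr => b _.
by rewrite !linearZ /= -tnth_nth.
Qed.

Lemma smooth_triv_frame (i : triv_idx E) (a : 'I_k) :
  smooth_section (triv_dom i) (fun x => tnth (triv_frame i x) a).
Proof. by move=> j b; rewrite setIC; apply: triv_smooth. Qed.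

Lemma exists_smooth_section (x : M) (u : E x) :
  exists (U : set M) (s : section E),
    [/\ open U, U x, smooth_section U s & s x = u].
Proof.
have [i dx] := triv_cover E x.
exists (triv_dom i), (fun y => \sum_(a : 'I_k)
  coord (triv_frame i x) a u *: tnth (triv_frame i y) a); split=> //.
- exact: triv_dom_open.
- apply: smooth_section_sum => [|a]; first exact: triv_dom_open.
  apply: smooth_section_scale (smooth_triv_frame i a).
    exact: triv_dom_open.
  exact: smooth_fun_cst.
- have bx : u \in <<triv_frame i x>>%VS.
    by rewrite (span_basis (triv_basis dx)) memvf.
  by rewrite {2}(coord_span bx); apply: eq_bigr => a _; rewrite -tnth_nth.
Qed.

End SmoothSections.

(** * Coordinates and frames *)

Section Coordinates.
Context {R : realType} {V : vectType R}.
Implicit Types (u w : V) (A : 'End(V)).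

Lemma coord_vbasis_inj u w :
  (forall i, coord (vbasis fullv) i u = coord (vbasis fullv) i w) -> u = w.
Proof.
move=> uw; rewrite (coord_vbasis (memvf u)) (coord_vbasis (memvf w)).
by apply: eq_bigr => i _; rewrite uw.
Qed.

Lemma coordD k (X : k.-tuple V) i u w :
  coord X i (u + w) = coord X i u + coord X i w.
Proof. exact: linearD. Qed.

Lemma coordZ k (X : k.-tuple V) i a u : coord X i (a *: u) = a * coord X i u.
Proof. exact: linearZ. Qed.

Lemma coordN k (X : k.-tuple V) i u : coord X i (- u) = - coord X i u.
Proof. exact: linearN. Qed.

Lemma endoD A u w : A (u + w) = A u + A w. Proof. exact: linearD. Qed.

Lemma endoZ A a u : A (a *: u) = a *: A u. Proof. exact: linearZ. Qed.

Lemma endoN A u : A (- u) = - A u. Proof. exact: linearN. Qed.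

End Coordinates.

Section FrameMul.
Context {R : realType} {V : vectType R}.

Lemma tnth_frame_mul k l (e : k.-tuple V) (A : 'M[R]_(k, l)) j :
  tnth (frame_mul e A) j = \sum_i A i j *: tnth e i.
Proof. by rewrite tnth_mktuple. Qed.

Lemma frame_mulA k l p (e : k.-tuple V) (A : 'M[R]_(k, l)) (B : 'M[R]_(l, p)) :
  frame_mul (frame_mul e A) B = frame_mul e (A *m B).
Proof.
apply: eq_from_tnth => j; rewrite !tnth_frame_mul.
under eq_bigr do rewrite tnth_frame_mul scaler_sumr.
rewrite exchange_big; apply: eq_bigr => i _; rewrite mxE scaler_suml.
by apply: eq_bigr => b _; rewrite scalerA mulrC.
Qed.

Lemma frame_mul1 k (e : k.-tuple V) : frame_mul e 1%:M = e.
Proof.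
apply: eq_from_tnth => j; rewrite tnth_frame_mul (bigD1 j) //= mxE eqxx scale1r.
by rewrite big1 ?addr0 // => i /negPf ij; rewrite mxE ij scale0r.
Qed.

Lemma map_frame_mul k l (F : 'End(V)) (e : k.-tuple V) (A : 'M[R]_(k, l)) :
  map_tuple F (frame_mul e A) = frame_mul (map_tuple F e) A.
Proof.
apply: eq_from_tnth => j; rewrite tnth_map !tnth_frame_mul linear_sum.
by apply: eq_bigr => i _; rewrite linearZ tnth_map.
Qed.

Lemma frame_mul_inj k l (e : k.-tuple V) (A B : 'M[R]_(k, l)) :
  free e -> frame_mul e A = frame_mul e B -> A = B.
Proof.
move=> fe AB; apply/matrixP => i j; have := congr1 (@tnth _ _ ^~ j) AB.
rewrite !tnth_frame_mul; under eq_bigr do rewrite (tnth_nth 0).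
under [X in _ = X]eq_bigr do rewrite (tnth_nth 0).
by move/(congr1 (coord e i)); rewrite !coord_sum_free.
Qed.

(** The matrix whose column j holds the coordinates of [tnth e' j] in e. *)
Definition coord_mx k l (e : k.-tuple V) (e' : l.-tuple V) : 'M[R]_(k, l) :=
  \matrix_(a, b) coord e a (tnth e' b).

Lemma frame_mul_coord k l (e : k.-tuple V) (e' : l.-tuple V) :
  basis_of fullv e -> frame_mul e (coord_mx e e') = e'.
Proof.
move=> be; apply: eq_from_tnth => j; rewrite tnth_frame_mul.
rewrite [RHS](coord_basis be (memvf _)).
by apply: eq_bigr => i _; rewrite mxE -tnth_nth.
Qed.

Lemma coord_mx_frame_mul k l p (e : k.-tuple V) (e' : l.-tuple V)
    (A : 'M[R]_(l, p)) :
  coord_mx e (frame_mul e' A) = coord_mx e e' *m A.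
Proof.
apply/matrixP => i j; rewrite !mxE tnth_frame_mul linear_sum.
by apply: eq_bigr => a _; rewrite mxE linearZ /= mulrC.
Qed.

Lemma coord_mx_trans k l p (e : k.-tuple V) (e' : l.-tuple V)
    (e'' : p.-tuple V) :
  basis_of fullv e' -> coord_mx e e'' = coord_mx e e' *m coord_mx e' e''.
Proof. by move=> be'; rewrite -coord_mx_frame_mul frame_mul_coord. Qed.

Lemma coord_mx_id k (e : k.-tuple V) : free e -> coord_mx e e = 1%:M.
Proof.
move=> fe; apply/matrixP => i j.
by rewrite !mxE (tnth_nth 0) coord_free // eq_sym.
Qed.

Lemma det_coord_mx_neq0 k (e e' : k.-tuple V) :
  basis_of fullv e -> basis_of fullv e' -> \det (coord_mx e e') != 0.
Proof.
move=> be be'; apply/eqP => d0; have := coord_mx_trans e e be'.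
rewrite coord_mx_id ?(basis_free be) // => /(congr1 determinant).
by rewrite det1 det_mulmx d0 mul0r => /eqP; rewrite oner_eq0.
Qed.

Lemma basis_frame_mul k (e : k.-tuple V) (A : 'M[R]_k) :
  basis_of fullv e -> A \in unitmx -> basis_of fullv (frame_mul e A).
Proof.
move=> be uA; rewrite basisEfree subvf size_tuple (size_basis be) leqnn !andbT.
apply/freeP => c.
pose C : 'cV[R]_k := \col_i c i; move=> c0.
suff C0 : A *m C = 0.
  move=> i; have := congr1 (mulmx (invmx A)) C0.
  by rewrite mulKmx // mulmx0 => /matrixP /(_ i 0); rewrite !mxE.
apply: (frame_mul_inj (basis_free be)); rewrite -frame_mulA.
apply: eq_from_tnth => j; rewrite !tnth_frame_mul.
rewrite [RHS]big1 => [|i _]; last by rewrite mxE scale0r.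
rewrite -[RHS]c0; apply: eq_bigr => i _.
by rewrite mxE (tnth_nth 0).
Qed.

End FrameMul.

(** * The group H *)

Section Hgroup.
Context {R : realType} (n : nat).
Local Notation eta := (@neutral_mx R n).

(** The matrices through which I and J1 act on a frame of the form
    (u, I u, J1 u, I J1 u). *)
Definition LI : 'M[R]_(fourn n) :=
  block_mx (block_mx 0 (- 1%:M) 1%:M 0) 0 0 (block_mx 0 (- 1%:M) 1%:M 0).
Definition LJ : 'M[R]_(fourn n) :=
  block_mx 0 (block_mx 1%:M 0 0 (- 1%:M)) (block_mx 1%:M 0 0 (- 1%:M)) 0.

Lemma LI_LJ_Lambda : LI + LI *m LJ = Lambda_mx n.
Proof.
by rewrite /LI /LJ /Lambda_mx !(mulmx_block, mulmx0, mul0mx, mulmxN, mulNmx,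
  mulmx1, mul1mx, addr0, add0r, oppr0, opprK, add_block_mx).
Qed.

(** The block pattern of the elements of H; it is the commutant of [LI] and
    [LJ]. *)
Definition H_form (A : 'M[R]_(fourn n)) :=
  exists A11 A21 A31 A41 : 'M[R]_n, A = block_mx
    (block_mx A11 (- A21) A21 A11)  (block_mx A31 A41 (- A41) A31)
    (block_mx A31 (- A41) A41 A31)  (block_mx A11 A21 (- A21) A11).

Lemma commute_H_form A : A *m LI = LI *m A -> A *m LJ = LJ *m A -> H_form A.
Proof.
rewrite -[A]submxK -[ulsubmx A]submxK -[ursubmx A]submxK -[dlsubmx A]submxK.
rewrite -[drsubmx A]submxK.
move: (ulsubmx (ulsubmx A)) (ursubmx (ulsubmx A)) (dlsubmx (ulsubmx A))
  (drsubmx (ulsubmx A)) (ulsubmx (ursubmx A)) (ursubmx (ursubmx A))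
  (dlsubmx (ursubmx A)) (drsubmx (ursubmx A)) (ulsubmx (dlsubmx A))
  (ursubmx (dlsubmx A)) (dlsubmx (dlsubmx A)) (drsubmx (dlsubmx A))
  (ulsubmx (drsubmx A)) (ursubmx (drsubmx A)) (dlsubmx (drsubmx A))
  (drsubmx (drsubmx A)) => {A} a b c d e f g k p q r s w x y z.
rewrite /LI /LJ !(mulmx_block, mulmx0, mul0mx, mulmxN, mulNmx, mulmx1,
  mul1mx, addr0, add0r, oppr0, opprK).
case/eq_block_mx => /eq_block_mx[hb _ hd _] /eq_block_mx[hf _ hk _].
case/eq_block_mx => hq _ hs _ /eq_block_mx[hx _ hz _].
case/eq_block_mx => /eq_block_mx[he _ hg _] /eq_block_mx[ha _ hc _] _ _.
exists w, (- y), p, r.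
by rewrite hb hd hf hk hq hs hx hz he hg ha hc !opprK.
Qed.

Lemma det_block_sym k (X Y : 'M[R]_k) :
  \det (block_mx X Y Y X) = \det (X + Y) * \det (X - Y).
Proof.
pose L : 'M[R]_(k + k) := block_mx 1%:M 1%:M 0 1%:M.
pose U : 'M[R]_(k + k) := block_mx 1%:M (- 1%:M) 0 1%:M.
have <- : \det (L *m block_mx X Y Y X *m U) = \det (block_mx X Y Y X).
  by rewrite !det_mulmx !det_ublock !det1 !mul1r mulr1.
rewrite !mulmx_block !(mulmx0, mul0mx, mulmxN, mulNmx, mulmx1,
  mul1mx, addr0, add0r).
by rewrite [Y + X]addrC addNr det_lblock (addrC (- Y)).
Qed.

(** Over the reals the paraquaternions are the 2 x 2 matrices, so that such a
    determinant is a square.  Concretely, conjugation by the signed diagonal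
    matrix S leads to the situation of [det_block_sym], where the two factors
    agree because X - Y is conjugate to X + Y. *)
Lemma H_form_det_ge0 A : H_form A -> 0 <= \det A.
Proof.
case=> a [c] [p] [r] {A}->.
pose T : 'M[R]_(n + n) := block_mx 1%:M 0 0 (- 1%:M).
pose S := block_mx (1%:M : 'M[R]_(n + n)) 0 0 T.
pose X := block_mx a (- c) c a; pose Y := block_mx p (- r) (- r) (- p).
have SS : S *m S = 1%:M.
  by rewrite /S /T !mulmx_block !(mulmx0, mul0mx, mulmxN, mulNmx, mulmx1,
    mul1mx, addr0, add0r, oppr0, opprK, mulmx_block) -!scalar_mx_block.
have detS : \det S * \det S = 1 by rewrite -det_mulmx SS det1.
set A := (X in \det X); have SAS : S *m A *m S = block_mx X Y Y X.
  by rewrite /A /S /T !(mulmx_block, mulmx0, mul0mx, mulmxN, mulNmx, mulmx1,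
    mul1mx, addr0, add0r, oppr0, opprK).
pose K : 'M[R]_(n + n) := block_mx 0 (- 1%:M) 1%:M 0.
have KK : K *m (- K) = 1%:M.
  by rewrite mulmxN mulmx_block !(mulmx0, mul0mx, mulmxN, mulNmx, mulmx1,
    mul1mx, addr0, add0r, oppr0) opp_block_mx !(oppr0, opprK) -scalar_mx_block.
have KXY : K *m (X + Y) = (X - Y) *m K.
  rewrite opp_block_mx !add_block_mx !mulmx_block !(mulmx0, mul0mx, mulmxN,
    mulNmx, mulmx1, mul1mx, addr0, add0r, oppr0, opprK).
  by rewrite !opprD !opprK.
have dK : \det K != 0.
  apply/eqP => dK0; move/(congr1 determinant): KK.
  by rewrite det_mulmx dK0 mul0r det1 => /eqP; rewrite eq_sym oner_eq0.
have dXY : \det (X - Y) = \det (X + Y).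
  by apply: (mulfI dK); rewrite -[RHS]det_mulmx KXY det_mulmx mulrC.
have <- : \det (S *m A *m S) = \det A.
  by rewrite !det_mulmx mulrAC detS mul1r.
by rewrite SAS det_block_sym dXY -expr2 sqr_ge0.
Qed.

Lemma det_eta_neq0 : \det eta != 0.
Proof.
rewrite /neutral_mx det_ublock det1 mul1r -scaleN1r detZ det1 mulr1.
by rewrite signr_eq0.
Qed.

(** An isometry that commutes with [LI] and [LJ] has determinant 1 or -1, hence
    determinant 1 by [H_form_det_ge0]. *)
Lemma commute_H_group A : A^T *m eta *m A = eta ->
  A *m LI = LI *m A -> A *m LJ = LJ *m A -> H_group n A.
Proof.
move=> AA AI AJ; have HA := commute_H_form AI AJ; split=> //; split=> //.
have /eqP := congr1 determinant AA; rewrite !det_mulmx det_tr mulrAC.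
rewrite -[X in _ == X]mul1r (inj_eq (mulIf det_eta_neq0)) -expr2 sqrf_eq1.
case/orP => /eqP // dA; have := H_form_det_ge0 HA.
by rewrite dA oppr_ge0 ler10.
Qed.
End Hgroup.

(** * The Lie algebra of H *)

Section RationalFunctions.
Context {R : realType}.
Implicit Types (f : R -> R) (p q : {poly R}).

(** On the interval |t| < d, f is a quotient of polynomials with nonvanishing
    denominator. *)
Definition rational_on (d : R) f := exists p q, forall t, `|t| < d ->
  q.[t] != 0 /\ f t = p.[t] / q.[t].

Lemma near_norm_lt (d t : R) : `|t| < d -> \forall u \near t, `|u| < d.
Proof.
rewrite ltr_norml => td; have tin : t \in `]- d, d[ by rewrite in_itv.
by apply: filterS (near_in_itvoo tin) => u; rewrite in_itv /= ltr_norml.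
Qed.

Lemma rational_on_derive d f : rational_on d f ->
  (forall t, `|t| < d -> derivable f t (1 : R)) /\ rational_on d (derive1 f).
Proof.
case=> p [q fpq].
have dfpq t : `|t| < d ->
    is_derive t (1 : R) f ((p^`() * q - p * q^`()).[t] / (q ^+ 2).[t]).
  move=> td; have [q0 _] := fpq t td.
  have near_f : \forall u \near t, p.[u] * (q.[u])^-1 = f u.
    by apply: filterS (near_norm_lt td) => u /fpq[_ ->].
  apply: (near_eq_is_derive near_f).
  have dV := is_deriveV q0 (is_derive_poly q t).
  have [dM eM] := is_deriveM (is_derive_poly p t) dV.
  apply: DeriveDef; first exact: dM.
  apply: (etrans eM); rewrite !hornerE /GRing.scale /=; field; exact: q0.
split; first by move=> t /dfpq [].
exists (p^`() * q - p * q^`()), (q ^+ 2) => t td; have [q0 _] := fpq t td.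
split; first by rewrite horner_exp expf_neq0.
by rewrite derive1E; have [_ ->] := dfpq t td.
Qed.

Lemma rational_on_derivable d f k t : rational_on d f -> `|t| < d ->
  derivable (derive1n k f) t (1 : R).
Proof.
move=> rf td; suff /rational_on_derive[+ _] : rational_on d (derive1n k f).
  exact.
elim: k => [|k IH] //; rewrite derive1nS.
by case: (rational_on_derive IH).
Qed.

End RationalFunctions.

Section LieAlgebra.
Context {R : realType} (n : nat).
Local Notation eta := (@neutral_mx R n).
Local Notation mx := 'M[R]_(fourn n).

Lemma commute_invmx k (A L : 'M[R]_k) : A \in unitmx ->
  A *m L = L *m A -> invmx A *m L = L *m invmx A.
Proof.
move=> uA AL; rewrite -[LHS]mulmx1 -(mulmxV uA) !mulmxA; congr (_ *m _).
by rewrite -[invmx A *m L *m A]mulmxA -AL mulmxA mulVmx // mul1mx.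
Qed.

(** The Cayley transform of a skew matrix is an isometry, and it commutes with
    whatever the matrix commutes with. *)
Lemma cayley_H (Y : mx) (P := 1%:M - Y) (Q := 1%:M + Y) : P \in unitmx ->
  Y^T *m eta + eta *m Y = 0 -> Y *m LI n = LI n *m Y -> Y *m LJ n = LJ n *m Y ->
  H_group n (invmx P *m Q).
Proof.
move=> uP skY YI YJ; have PQ : P *m Q = Q *m P.
  rewrite /P /Q mulmxBl mulmxDl mulmxDr mulmxBr !mul1mx !mulmx1.
  by rewrite mulmxDr mulmx1 addrKA addrA subrK.
have comm L : Y *m L = L *m Y -> invmx P *m Q *m L = L *m (invmx P *m Q).
  move=> YL; have QL : Q *m L = L *m Q by
    rewrite /Q mulmxDl mulmxDr YL mul1mx mulmx1.
  have PL : P *m L = L *m P by rewrite /P mulmxBl mulmxBr YL mul1mx mulmx1.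
  by rewrite -mulmxA QL mulmxA commute_invmx // -mulmxA.
have skY' : Y^T *m eta = - (eta *m Y) by apply/eqP; rewrite -addr_eq0 skY.
have Pe : P^T *m eta = eta *m Q.
  by rewrite linearB /= trmx1 mulmxBl mul1mx skY' opprK mulmxDr mulmx1.
have Qe : Q^T *m eta = eta *m P.
  by rewrite linearD /= trmx1 mulmxDl mul1mx skY' mulmxBr mulmx1.
have CP : invmx P *m Q *m P = Q by rewrite -mulmxA -PQ mulKmx.
move: (comm _ YI) (comm _ YJ) CP; move: (invmx P *m Q) => C CI CJ CP.
apply: commute_H_group => //; have uPt : P^T \in unitmx by rewrite unitmx_tr.
apply: (can_inj (mulKmx uPt)); apply: (can_inj (mulmxK uP)).
rewrite !mulmxA -trmx_mul CP -(mulmxA _ C) CP Qe Pe.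
by rewrite -!mulmxA PQ.
Qed.

(** A matrix that is skew for the neutral form and commutes with [LI] and [LJ]
    is the velocity of the curve of the Cayley transforms of t X / 2, whose
    entries are rational functions of t. *)
Lemma lie_algebra_H (X : mx) :
  X^T *m eta + eta *m X = 0 -> X *m LI n = LI n *m X -> X *m LJ n = LJ n *m X ->
  lie_algebra (H_group n) X.
Proof.
move=> skX XI XJ; pose Y : mx := 2^-1 *: X.
pose P (t : R) : mx := 1%:M - t *: Y; pose Q (t : R) : mx := 1%:M + t *: Y.
pose pP : 'M[{poly R}]_(fourn n) := 1%:M - 'X *: map_mx polyC Y.
pose pQ : 'M[{poly R}]_(fourn n) := 1%:M + 'X *: map_mx polyC Y.
have evY t : map_mx (horner_eval t) (map_mx polyC Y) = Y.
  by apply/matrixP => i j; rewrite !mxE /horner_eval hornerC.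
have evP t : map_mx (horner_eval t) pP = P t.
  rewrite map_mxB map_mx1 map_mxZ evY /= /horner_eval hornerX //.
have evQ t : map_mx (horner_eval t) pQ = Q t.
  rewrite map_mxD map_mx1 map_mxZ evY /= /horner_eval hornerX //.
have detP t : (\det pP).[t] = \det (P t).
  by rewrite -evP det_map_mx.
have d0 : (\det pP).[0] != 0 by rewrite detP /P scale0r subr0 det1 oner_eq0.
have [d d_gt0 dP] : exists2 d : R, 0 < d & forall t, `|t| < d -> P t \in unitmx.
  have : \forall t \near (0 : R), (\det pP).[t] != 0.
    exact: (cvgr_neq0 _ (@continuous_horner _ (\det pP) 0)).
  case/nbhs_ballP => d /= d_gt0 dP; exists d => // t td.
  by rewrite unitmxE unitfE -detP; apply: dP; rewrite /ball /= sub0r normrN.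
pose c t : mx := invmx (P t) *m Q t.
have rc i j : rational_on d (fun t => c t i j).
  exists ((\adj pP *m pQ) i j), (\det pP) => t td; have uP := dP t td.
  split; first by rewrite detP -unitfE -unitmxE.
  rewrite detP /c /invmx uP -scalemxAl mxE mulrC; congr (_ / _).
  rewrite -evP -evQ -map_mx_adj -map_mxM mxE //.
have c0 : c 0 = 1%:M by rewrite /c /P /Q !scale0r subr0 addr0 invmx1 mulmx1.
exists c, d; split=> //.
- move=> t td; apply: cayley_H; first exact: dP.
  + rewrite linearZ /= linearZ /= -!scalemxAl -!scalemxAr -!scalerDr skX.
    by rewrite !scaler0.
  + by rewrite -!scalemxAl -!scalemxAr XI.
  + by rewrite -!scalemxAl -!scalemxAr XJ.
- by move=> t k i j td; apply: rational_on_derivable (rc i j) td.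
(* c t = 1 + t (Y + Y (c t)), hence c' 0 = Y + Y (c 0) = X. *)
move=> i j; pose g t := (Y + Y *m c t) i j.
have dg : derivable g 0 (1 : R).
  have -> : g = cst (Y i j) + \sum_k (fun t => Y i k *: c t k j).
    by apply/funext => t; rewrite /g fct_sumE !mxE.
  apply: derivableD; first exact: derivable_cst.
  apply: derivable_sum => k; apply: derivableZ.
  have d00 : `|0 : R| < d by rewrite normr0.
  exact: (@rational_on_derivable _ _ _ 0 _ (rc k j) d00).
have cg : forall t, `|t| < d -> (1%:M : mx) i j + t * g t = c t i j.
  move=> t td.
  have : P t *m c t = Q t by rewrite /c mulmxA mulmxV ?dP // mul1mx.
  rewrite /P /Q mulmxBl mul1mx => /eqP; rewrite subr_eq -addrA -scalemxAl.
  rewrite -scalerDr => /eqP/matrixP/(_ i j) ->.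
  by rewrite [RHS]mxE; congr (_ + _); rewrite [RHS]mxE.
have near_c : \forall t \near (0 : R), (1%:M : mx) i j + t * g t = c t i j.
  by apply: filterS (near_norm_lt (_ : `|0| < d)) => [t|]; rewrite ?normr0 //;
    exact: cg.
have did := is_derive_id (0 : R) (1 : R).
have dgi : is_derive (0 : R) (1 : R) g ('D_1 g 0) by split.
have dc := is_deriveD (is_derive_cst ((1%:M : mx) i j) (0 : R) (1 : R))
  (is_deriveM did dgi).
rewrite derive1E; have [_ ->] := near_eq_is_derive near_c dc.
rewrite add0r scale0r add0r /g c0 mulmx1 /Y -scalerDl.
have -> : 2^-1 + 2^-1 = 1 :> R by lra.
by rewrite scale1r /GRing.scale /= mulr1.
Qed.

End LieAlgebra.

(** * Para-hermitian vector spaces *)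

Section ParaHermitian.
Context {R : realType} {V : vectType R}.
Variables (h : V -> V -> R) (I J : 'End(V)).

(** The structure induced on a fibre, given by two generators I and J of the
    paraquaternions; the third one is [I \o J].  An endomorphism of square 1
    (resp. -1) reverses (resp. preserves) h if and only if it is skew. *)
Record para_hermitian : Prop := ParaHermitian {
  ph_linear : forall v, scalar (h^~ v);
  ph_sym : forall u v, h u v = h v u;
  ph_nondeg : forall u, (forall v, h u v = 0) -> u = 0;
  ph_II : forall u, I (I u) = - u;
  ph_JJ : forall u, J (J u) = u;
  ph_JI : forall u, J (I u) = - I (J u);
  ph_skewI : forall u v, h (I u) v = - h u (I v);
  ph_skewJ : forall u v, h (J u) v = - h u (J v)
}.

Hypothesis ph : para_hermitian.

Lemma ph_D u v w : h (u + v) w = h u w + h v w.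
Proof. by have := ph_linear ph w 1 u v; rewrite /= scale1r mul1r. Qed.

Lemma ph_0 w : h 0 w = 0.
Proof. by apply: (addrI (h 0 w)); rewrite -ph_D !addr0. Qed.

Lemma ph_Z a u w : h (a *: u) w = a * h u w.
Proof. by have := ph_linear ph w a u 0; rewrite /= !addr0 ph_0 addr0. Qed.

Lemma ph_N u w : h (- u) w = - h u w.
Proof. by rewrite -scaleN1r ph_Z mulN1r. Qed.

Lemma ph_Dr u v w : h w (u + v) = h w u + h w v.
Proof. by rewrite !(ph_sym ph w) ph_D. Qed.

Lemma ph_Zr a u w : h w (a *: u) = a * h w u.
Proof. by rewrite !(ph_sym ph w) ph_Z. Qed.

Lemma ph_Nr u w : h w (- u) = - h w u.
Proof. by rewrite !(ph_sym ph w) ph_N. Qed.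

Lemma ph_sum (T : Type) (r : seq T) (F : T -> V) w :
  h (\sum_(i <- r) F i) w = \sum_(i <- r) h (F i) w.
Proof.
by elim/big_rec2: _ => [|i a b _ <-]; rewrite ?ph_0 ?ph_D.
Qed.

Lemma ph_sumr (T : Type) (r : seq T) (F : T -> V) w :
  h w (\sum_(i <- r) F i) = \sum_(i <- r) h w (F i).
Proof.
by rewrite (ph_sym ph) ph_sum; apply: eq_bigr => i _; rewrite (ph_sym ph).
Qed.

Lemma ph_gram k l (e : k.-tuple V) (A B : 'M[R]_(k, l)) (G : 'M[R]_k) a b :
  (forall i j, h (tnth e i) (tnth e j) = G i j) ->
  h (tnth (frame_mul e A) a) (tnth (frame_mul e B) b) = (A^T *m G *m B) a b.
Proof.
move=> eG; rewrite !tnth_frame_mul ph_sumr mxE; apply: eq_bigr => j _.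
rewrite ph_Zr ph_sum mxE mulrC; congr (_ * _).
by apply: eq_bigr => i _; rewrite ph_Z eG mxE.
Qed.

(** The first k vectors of u are orthonormal over the paraquaternions: together
    with their images under I, J and I J they are pseudo-orthonormal.  The
    family is indexed by nat so that it can be extended without casts. *)
Definition para_unitary k (u : nat -> V) := forall i j, (i < k)%N -> (j < k)%N ->
  [/\ h (u i) (u j) = (i == j)%:R, h (u i) (I (u j)) = 0,
      h (u i) (J (u j)) = 0 & h (u i) (I (J (u j))) = 0].

(** y is orthogonal to the paraquaternionic span of the first k vectors of u. *)
Definition para_ortho k (u : nat -> V) y := forall i, (i < k)%N ->
  [/\ h y (u i) = 0, h y (I (u i)) = 0, h y (J (u i)) = 0 &
      h y (I (J (u i))) = 0].

(* Moves I and J to the right argument of h and normalizes words in I and J. *)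
Definition ph_norm := (ph_skewI ph, ph_skewJ ph, ph_JI ph, ph_II ph, ph_JJ ph,
  ph_Nr, @endoN R V, @opprK R, @opprK V, @oppr0 R).

(** The orthogonal projection onto the paraquaternionic span of the first k
    vectors of u; J and I J reverse h, whence the signs. *)
Definition para_proj k (u : nat -> V) y : V := \sum_(i < k)
  (h y (u i) *: u i + h y (I (u i)) *: I (u i)
   + (- h y (J (u i)) *: J (u i) + - h y (I (J (u i))) *: I (J (u i)))).

Lemma para_proj_ortho k u y : para_unitary k u ->
  para_ortho k u (y - para_proj k u y).
Proof.
move=> uu j jk.
have proj (c1 c2 c3 c4 : 'I_k -> R) : 
    let p := \sum_(i < k) (c1 i *: u i + c2 i *: I (u i)
        + (c3 i *: J (u i) + c4 i *: I (J (u i)))) in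
    [/\ h p (u j) = c1 (Ordinal jk), h p (I (u j)) = c2 (Ordinal jk),
        h p (J (u j)) = - c3 (Ordinal jk) &
        h p (I (J (u j))) = - c4 (Ordinal jk)].
  move=> p.
  split; (rewrite ph_sum (bigD1 (Ordinal jk)) //=;
    have [e1 e2 e3 e4] := uu j j jk jk;
    rewrite !(ph_D, ph_Z) !ph_norm ?e1 ?e2 ?e3 ?e4 ?eqxx big1;
    [by rewrite !(mulr0, mulr1, mulrN, oppr0, addr0, add0r)
    |move=> i ij; have [f1 f2 f3 f4] := uu i j (ltn_ord i) jk;
     have ij' : (i == j :> nat) = false by [apply/negbTE];
     rewrite !(ph_D, ph_Z) !ph_norm ?f1 ?f2 ?f3 ?f4 ij';
     by rewrite !(mulr0, oppr0, addr0)]).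
have [p1 p2 p3 p4] := proj (fun i => h y (u i)) (fun i => h y (I (u i)))
  (fun i => - h y (J (u i))) (fun i => - h y (I (J (u i)))).
by split; rewrite ph_D ph_N /para_proj ?p1 ?p2 ?p3 ?p4 ?opprK subrr.
Qed.

Lemma para_proj_eq0 k u y : para_ortho k u y -> para_proj k u y = 0.
Proof.
move=> oy; apply: big1 => i _; have [-> -> -> ->] := oy i (ltn_ord i).
by rewrite !oppr0 !scale0r !addr0.
Qed.

Lemma para_orthoD k u y z :
  para_ortho k u y -> para_ortho k u z -> para_ortho k u (y + z).
Proof.
move=> oy oz i ik; have [y1 y2 y3 y4] := oy i ik; have [z1 z2 z3 z4] := oz i ik.
by rewrite !ph_D y1 y2 y3 y4 z1 z2 z3 z4 addr0.
Qed.

Lemma para_orthoZ k u a y : para_ortho k u y -> para_ortho k u (a *: y).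
Proof.
by move=> oy i ik; have [y1 y2 y3 y4] := oy i ik; rewrite !ph_Z y1 y2 y3 y4 mulr0.
Qed.

Lemma para_orthoJ k u y : para_ortho k u y -> para_ortho k u (J y).
Proof.
by move=> oy i ik; have [y1 y2 y3 y4] := oy i ik; rewrite !ph_norm y1 y2 y3 y4 oppr0.
Qed.

Lemma para_ortho_proj k u y z : para_ortho k u y -> h y (para_proj k u z) = 0.
Proof.
move=> oy; rewrite ph_sumr big1 // => i _; have [y1 y2 y3 y4] := oy i (ltn_ord i).
by rewrite !(ph_Dr, ph_Zr) y1 y2 y3 y4 !mulr0 !addr0.
Qed.

(** A vector outside the span of the paraquaternionic multiples of the u i has
    a nonzero component orthogonal to them, and h does not vanish identically
    on the orthogonal complement, being nondegenerate there. *)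
Lemma exists_para_ortho n k u : \dim (@fullv R V) = fourn n -> (k < n)%N ->
  para_unitary k u -> exists2 w, para_ortho k u w & h w w != 0.
Proof.
move=> dV kn uu.
pose X := [seq u i | i <- iota 0 k] ++ [seq I (u i) | i <- iota 0 k]
  ++ [seq J (u i) | i <- iota 0 k] ++ [seq I (J (u i)) | i <- iota 0 k].
have inX (i : 'I_k) : (i : nat) \in iota 0 k by rewrite mem_iota /= add0n.
have proj_span y : para_proj k u y \in <<X>>%VS.
  apply: memv_suml => i _.
  do 2!apply: memvD; apply: memvZ; apply: memv_span; rewrite !mem_cat;
    apply/or4P.
  - by apply: Or41; apply: map_f.
  - by apply: Or42; apply: (map_f (fun i => I (u i))).
  - by apply: Or43; apply: (map_f (fun i => J (u i))).
  - by apply: Or44; apply: (map_f (fun i => I (J (u i)))).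
have [y yX] : exists y, y \notin <<X>>%VS.
  apply: contrapT => /forallNP allX.
  have := dim_span X; rewrite !size_cat !size_map !size_iota leqNgt => /negP; apply.
  have -> : <<X>>%VS = fullv.
    apply/vspaceP => y; rewrite memvf; apply/negPn/negP; exact: allX.
  by rewrite dV; lia.
pose v := y - para_proj k u y; have ov : para_ortho k u v.
  exact: para_proj_ortho.
have v0 : v != 0.
  by apply: contraNneq yX => /eqP; rewrite subr_eq0 => /eqP ->.
have [z vz] : exists z, h v z != 0.
  apply: contrapT => /forallNP hv0; move/eqP: v0; apply.
  by apply: ph_nondeg ph _ _ => z; apply/eqP; have /negP := hv0 z; rewrite negbK.
pose z' := z - para_proj k u z; have oz' : para_ortho k u z'.
  exact: para_proj_ortho.
have vz' : h v z' = h v z.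
  by rewrite ph_Dr ph_Nr para_ortho_proj // subr0.
have [hvv|?] := eqVneq (h v v) 0; last by exists v.
have [hzz|?] := eqVneq (h z' z') 0; last by exists z'.
exists (v + z'); first exact: para_orthoD.
move: v z' hvv hzz vz' {ov v0 oz'} vz => v z' hvv hzz vz' vz.
rewrite !(ph_D, ph_Dr) hvv hzz (ph_sym ph z') vz' add0r addr0 -mulr2n.
by rewrite mulrn_eq0 negb_or.
Qed.

(** The action of a + b J multiplies h w w by a ^ 2 - b ^ 2 = (a + b) (a - b);
    with a + b = 1 and a - b = s, normalization needs neither a square root nor
    a condition on the sign of h w w. *)
Lemma para_normalize w (s := (h w w)^-1) : h w w != 0 ->
  let q := ((1 + s) / 2) *: w + ((1 - s) / 2) *: J w in h q q = 1.
Proof.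
move=> w0 q; have hJ : h w (J w) = 0.
  have : h w (J w) = - h w (J w) by rewrite {1}(ph_sym ph) ph_skewJ.
  lra.
rewrite !(ph_D, ph_Dr, ph_Z, ph_Zr) !ph_norm !hJ /s; field; exact: w0.
Qed.

Lemma para_unitary_extend k u q : para_unitary k u -> para_ortho k u q ->
  h q q = 1 -> para_unitary k.+1 (fun i => if i == k then q else u i).
Proof.
move=> uu oq qq i j; rewrite !ltnS.
have skew0 A : (forall u v, h (A u) v = - h u (A v)) -> h q (A q) = 0.
  move=> sA; have : h q (A q) = - h q (A q) by rewrite {1}(ph_sym ph) sA.
  lra.
have qI : h q (I q) = 0 by apply: skew0; apply: ph_skewI.
have qJ : h q (J q) = 0 by apply: skew0; apply: ph_skewJ.
have qIJ : h q (I (J q)) = 0.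
  by apply: (skew0 (fun x => I (J x))) => x y; rewrite !ph_norm.
rewrite (leq_eqVlt i) (leq_eqVlt j) => /predU1P[->|ik] /predU1P[->|jk].
- by rewrite !eqxx.
- by have [q1 q2 q3 q4] := oq j jk; rewrite eqxx (gtn_eqF jk) (ltn_eqF jk).
- have [q1 q2 q3 q4] := oq i ik; rewrite eqxx (ltn_eqF ik).
  rewrite !(ph_sym ph (u i)) !ph_norm q1 q2 q3 q4.
  by rewrite oppr0.
- by rewrite (ltn_eqF ik) (ltn_eqF jk); exact: uu.
Qed.

Section Frame.
Variable n : nat.

(** The bases in which h, I and J are given by the standard matrices. *)
Record adapted_frame (f : (fourn n).-tuple V) : Prop := AdaptedFrame {
  af_basis : basis_of fullv f;
  af_I : map_tuple I f = frame_mul f (LI n);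
  af_J : map_tuple J f = frame_mul f (LJ n);
  af_gram : forall a b, h (tnth f a) (tnth f b) = neutral_mx n a b
}.

(** The vectors u i, then the I (u i), the J (u i) and the I (J (u i)). *)
Definition para_frame (u : nat -> V) : (fourn n).-tuple V :=
  [tuple match fintype.split a with
         | inl b => match fintype.split b with inl i => u i | inr i => I (u i) end
         | inr b => match fintype.split b with inl i => J (u i) | inr i => I (J (u i)) end
         end | a < fourn n].

Lemma split_lshift k l (i : 'I_k) : fintype.split (lshift l i) = inl i.
Proof. exact: (unsplitK (inl i)). Qed.

Lemma split_rshift k l (i : 'I_l) : fintype.split (rshift k i) = inr i.
Proof. exact: (unsplitK (inr i)). Qed.

Lemma para_frame1 u i : tnth (para_frame u) (lshift _ (lshift _ i)) = u i.
Proof. by rewrite tnth_mktuple !split_lshift. Qed.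
Lemma para_frame2 u i : tnth (para_frame u) (lshift _ (rshift _ i)) = I (u i).
Proof. by rewrite tnth_mktuple split_lshift split_rshift. Qed.
Lemma para_frame3 u i : tnth (para_frame u) (rshift _ (lshift _ i)) = J (u i).
Proof. by rewrite tnth_mktuple split_rshift split_lshift. Qed.
Lemma para_frame4 u i :
  tnth (para_frame u) (rshift _ (rshift _ i)) = I (J (u i)).
Proof. by rewrite tnth_mktuple !split_rshift. Qed.
Definition para_frameE := (para_frame1, para_frame2, para_frame3, para_frame4).

Lemma ord4n_ind (P : 'I_(fourn n) -> Prop) :
  (forall i, P (lshift _ (lshift _ i))) -> (forall i, P (lshift _ (rshift _ i))) ->
  (forall i, P (rshift _ (lshift _ i))) -> (forall i, P (rshift _ (rshift _ i))) ->
  forall a, P a.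
Proof.
move=> P1 P2 P3 P4 a; case: (split_ordP a) => b ->; case: (split_ordP b) => i ->.
all: by [].
Qed.

Lemma frame_mul_sum4 (f : (fourn n).-tuple V) (A : 'M[R]_(fourn n)) j :
  tnth (frame_mul f A) j =
    (\sum_i A (lshift _ (lshift _ i)) j *: tnth f (lshift _ (lshift _ i))
     + \sum_i A (lshift _ (rshift _ i)) j *: tnth f (lshift _ (rshift _ i)))
  + (\sum_i A (rshift _ (lshift _ i)) j *: tnth f (rshift _ (lshift _ i))
     + \sum_i A (rshift _ (rshift _ i)) j *: tnth f (rshift _ (rshift _ i))).
Proof. by rewrite tnth_frame_mul !big_split_ord. Qed.

Lemma sum_scalar_mx (c : R) (g : 'I_n -> V) j :
  \sum_i (c%:M : 'M[R]_n) i j *: g i = c *: g j.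
Proof.
rewrite (bigD1 j) //= mxE eqxx mulr1n big1 ?addr0 // => i /negPf ij.
by rewrite mxE ij mulr0n scale0r.
Qed.

Let N1 : (- 1)%:M = - 1%:M :> 'M[R]_n. Proof. by rewrite raddfN. Qed.
Let Z0 : 0%:M = 0 :> 'M[R]_n. Proof. by rewrite raddf0. Qed.

Let LI_scalar : LI n = block_mx
  (block_mx 0%:M (- 1)%:M 1%:M 0%:M) (block_mx 0%:M 0%:M 0%:M 0%:M)
  (block_mx 0%:M 0%:M 0%:M 0%:M) (block_mx 0%:M (- 1)%:M 1%:M 0%:M) :> 'M[R]__.
Proof. by rewrite N1 Z0 block_mx0. Qed.

Let LJ_scalar : LJ n = block_mx
  (block_mx 0%:M 0%:M 0%:M 0%:M) (block_mx 1%:M 0%:M 0%:M (- 1)%:M)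
  (block_mx 1%:M 0%:M 0%:M (- 1)%:M) (block_mx 0%:M 0%:M 0%:M 0%:M) :> 'M[R]__.
Proof. by rewrite N1 Z0 block_mx0. Qed.

Let eta_scalar : neutral_mx n = block_mx
  (block_mx 1%:M 0%:M 0%:M 1%:M) (block_mx 0%:M 0%:M 0%:M 0%:M)
  (block_mx 0%:M 0%:M 0%:M 0%:M) (block_mx (- 1)%:M 0%:M 0%:M (- 1)%:M)
  :> 'M[R]__.
Proof.
by rewrite N1 Z0 block_mx0 /neutral_mx !scalar_mx_block opp_block_mx !oppr0.
Qed.

Definition block_mxEE := (@block_mxEul R, @block_mxEur R, @block_mxEdl R, @block_mxEdr R).

Lemma para_frame_I u : map_tuple I (para_frame u) = frame_mul (para_frame u) (LI n).
Proof.
apply: eq_from_tnth; apply: ord4n_ind => i.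
all: rewrite tnth_map frame_mul_sum4 LI_scalar.
all: under [X in _ = (X + _) + _]eq_bigr do rewrite para_frameE !block_mxEE.
all: under [X in _ = (_ + X) + _]eq_bigr do rewrite para_frameE !block_mxEE.
all: under [X in _ = _ + (X + _)]eq_bigr do rewrite para_frameE !block_mxEE.
all: under [X in _ = _ + (_ + X)]eq_bigr do rewrite para_frameE !block_mxEE.
all: rewrite !sum_scalar_mx !(scale0r, scale1r, scaleN1r, addr0, add0r) para_frameE.
all: rewrite ?(ph_II ph) //.
Qed.

Lemma para_frame_J u : map_tuple J (para_frame u) = frame_mul (para_frame u) (LJ n).
Proof.
apply: eq_from_tnth; apply: ord4n_ind => i.
all: rewrite tnth_map frame_mul_sum4 LJ_scalar.
all: under [X in _ = (X + _) + _]eq_bigr do rewrite para_frameE !block_mxEE.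
all: under [X in _ = (_ + X) + _]eq_bigr do rewrite para_frameE !block_mxEE.
all: under [X in _ = _ + (X + _)]eq_bigr do rewrite para_frameE !block_mxEE.
all: under [X in _ = _ + (_ + X)]eq_bigr do rewrite para_frameE !block_mxEE.
all: rewrite !sum_scalar_mx !(scale0r, scale1r, scaleN1r, addr0, add0r) para_frameE.
all: rewrite ?(ph_JI ph) ?(ph_JJ ph) //.
Qed.

Lemma para_frame_gram u a b : para_unitary n u ->
  h (tnth (para_frame u) a) (tnth (para_frame u) b) = neutral_mx n a b.
Proof.
move=> uu; rewrite eta_scalar; move: a b.
apply: ord4n_ind => i; apply: ord4n_ind => j; rewrite !para_frameE !block_mxEE.
all: have [u1 u2 u3 u4] := uu i j (ltn_ord i) (ltn_ord j).
all: rewrite ?ph_norm ?u1 ?u2 ?u3 ?u4 mxE -[i == j]/(i == j :> nat).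
all: by rewrite ?(oppr0, mul0rn, mulr1n, mulNrn).
Qed.

Lemma gram_free (f : (fourn n).-tuple V) :
  (forall a b, h (tnth f a) (tnth f b) = neutral_mx n a b) -> free f.
Proof.
move=> gf; apply/freeP => c c0; pose C : 'rV[R]_(fourn n) := \row_i c i.
have Ceta : C *m neutral_mx n = 0.
  apply/rowP => j; rewrite [LHS]mxE [RHS]mxE.
  rewrite -[RHS](_ : h (\sum_i c i *: f`_i) (tnth f j) = 0); last by rewrite c0 ph_0.
  rewrite ph_sum; apply: eq_bigr => i _; rewrite ph_Z -tnth_nth gf.
  by rewrite [C _ _]mxE.
have ue : (neutral_mx n : 'M[R]_(fourn n)) \in unitmx by rewrite unitmxE unitfE det_eta_neq0.
move=> i; have := mulmxK ue C; rewrite Ceta mul0mx => /rowP/(_ i).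
by rewrite !mxE.
Qed.

Lemma adapted_para_frame u : \dim (@fullv R V) = fourn n ->
  para_unitary n u -> adapted_frame (para_frame u).
Proof.
move=> dV uu; have gf a b := para_frame_gram a b uu.
split=> //; [|exact: para_frame_I|exact: para_frame_J].
by rewrite basisEfree gram_free // subvf dV size_tuple leqnn.
Qed.

Lemma adapted_frame_trans f f' : adapted_frame f -> adapted_frame f' ->
  H_group n (coord_mx f f').
Proof.
move=> af af'; have bf := af_basis af; have ff' := frame_mul_coord f' bf.
apply: commute_H_group.
- apply/matrixP => a b; rewrite -(af_gram af') -[in RHS]ff'.
  by rewrite (ph_gram _ _ _ _ (af_gram af)).
- apply: (frame_mul_inj (basis_free bf)).
  by rewrite -!frame_mulA ff' -(af_I af') -(af_I af) -map_frame_mul ff'.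
- apply: (frame_mul_inj (basis_free bf)).
  by rewrite -!frame_mulA ff' -(af_J af') -(af_J af) -map_frame_mul ff'.
Qed.

Lemma adapted_frame_Lambda f : adapted_frame f ->
  map_tuple (I + (I \o J)%VF) f = frame_mul f (Lambda_mx n).
Proof.
move=> af; rewrite -LI_LJ_Lambda; apply: eq_from_tnth => j.
rewrite tnth_map add_lfunE comp_lfunE tnth_frame_mul.
under eq_bigr do rewrite mxE scalerDl.
rewrite big_split -!tnth_frame_mul -frame_mulA -(af_I af) tnth_map.
by rewrite -map_frame_mul tnth_map -(af_J af) tnth_map.
Qed.

End Frame.
End ParaHermitian.

(** * Local adapted frames *)

Section LocalFrames.
Context {R : realType} {m : nat} {M : manifold R m} {n : nat}.
Context {E : bundle M (fourn n)} (h : neutral_metric E).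
Variables (I J : endo_section E).

Lemma dim_fiber x : \dim (@fullv R (E x)) = fourn n.
Proof. by have [i dx] := triv_cover E x; exact: size_basis (triv_basis dx). Qed.

Lemma metric0 x w : h x 0 w = 0.
Proof.
by have := metric_linear h w (-1) 0 0; rewrite /= scaler0 addr0 mulN1r addNr.
Qed.

Lemma metricZ x a u w : h x (a *: u) w = a * h x u w.
Proof. by have := metric_linear h w a u 0; rewrite /= addr0 metric0 addr0. Qed.

Lemma metricNr x u w : h x u (- w) = - h x u w.
Proof. by rewrite !(Defs.metric_sym h u) -scaleN1r metricZ mulN1r. Qed.

Lemma metric_nondeg x u : (forall v, h x u v = 0) -> u = 0.
Proof.
have [e [be he]] := metric_signature h x; move=> hu.
have /coord_span uE : u \in <<e>>%VS by rewrite (span_basis be) memvf.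
have hsum (r : seq 'I_(fourn n)) (F : 'I_(fourn n) -> E x) w :
    h x (\sum_(i <- r) F i) w = \sum_(i <- r) h x (F i) w.
  elim/big_rec2: _ => [|i a b _ <-]; first exact: metric0.
  by have := metric_linear h w 1 (F i) b; rewrite /= scale1r mul1r.
rewrite uE big1 // => i _; pose c : 'rV[R]_(fourn n) := \row_i coord e i u.
have ue : (neutral_mx n : 'M[R]_(fourn n)) \in unitmx.
  by rewrite unitmxE unitfE det_eta_neq0.
suff c0 : c = 0 by have /rowP/(_ i) := c0; rewrite !mxE => ->; rewrite scale0r.
rewrite -[c](mulmxK ue) (_ : c *m _ = 0) ?mul0mx //.
apply/rowP => j; rewrite [LHS]mxE [RHS]mxE -[RHS](hu (tnth e j)) [in RHS]uE hsum.
by apply: eq_bigr => k _; rewrite metricZ -tnth_nth he [c _ _]mxE.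
Qed.

Hypotheses (smI : smooth_endo I) (smJ : smooth_endo J).
Hypothesis ph : forall x, para_hermitian (h x) (I x) (J x).

Lemma smooth_metric (U : set M) (s t : section E) : open U ->
  smooth_section U s -> smooth_section U t ->
  smooth_fun U (fun x => h x (s x) (t x)).
Proof.
move=> oU ss st; apply: (@smooth_fun_cover _ _ _ _ (@triv_dom _ _ _ _ E)).
  by move=> x _; have [i dx] := triv_cover E x; exists i.
move=> i; set Ui := U `&` _; have oUi : open Ui.
  by apply: openI => //; exact: triv_dom_open.
have sh a b := smooth_fun_sub (@subIsetr _ U (@triv_dom _ _ _ _ E i))
  (metric_smooth h i a b).
have := smooth_fun_sum (index_enum 'I_(fourn n)) oUi (fun b =>
  smooth_fun_mul oUi (st i b) (smooth_fun_sum (index_enum 'I_(fourn n)) oUi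
    (fun a => smooth_fun_mul oUi (ss i a) (sh a b)))).
apply: smooth_fun_eq => // x [_ dx].
have bx (v : E x) : v \in <<triv_frame i x>>%VS.
  by rewrite (span_basis (triv_basis dx)) memvf.
rewrite [in RHS](coord_span (bx (s x))) [in RHS](coord_span (bx (t x))).
rewrite (ph_sumr (ph x)); apply: eq_bigr => b _.
rewrite (ph_Zr (ph x)) (ph_sum (ph x)); congr (_ * _); apply: eq_bigr => a _.
by rewrite (ph_Z (ph x)) -!tnth_nth.
Qed.

(** Gram-Schmidt over the paraquaternions: a vector at x0 orthogonal to the
    previous ones is extended to a section, projected onto the orthogonal
    complement, and normalized where its square does not vanish. *)
Lemma local_para_unitary x0 k : (k <= n)%N ->
  exists (U : set M) (u : nat -> section E), [/\ open U, U x0,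
    forall i, smooth_section U (u i) &
    forall x, U x -> para_unitary (h x) (I x) (J x) k (fun i => u i x)].
Proof.
elim: k => [_|k IH kn].
  exists setT, (fun _ x => 0); split=> //; first exact: openT.
  by move=> i; apply: smooth_section_zero; exact: openT.
have [U [u [oU Ux0 su uu]]] := IH (ltnW kn).
have [w ow w0] := exists_para_ortho (ph x0) (dim_fiber x0) kn (uu x0 Ux0).
have [V [s [oV Vx0 ss sx0]]] := exists_smooth_section w.
have oW := openI oU oV; set W := U `&` V in oW.
pose t : section E := fun x =>
  s x - para_proj (h x) (I x) (J x) k (fun i => u i x) (s x).
have suW i : smooth_section W (u i) := smooth_section_sub (@subIsetl _ U V) (su i).
have ssW : smooth_section W s := smooth_section_sub (@subIsetr _ U V) ss.
have st : smooth_section W t.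
  apply: smooth_section_add => //; apply: smooth_section_opp => //.
  apply: smooth_section_sum => // i.
  have sI s' : smooth_section W s' -> smooth_section W (fun x => I x (s' x)).
    exact: smooth_section_endo.
  have sJ s' : smooth_section W s' -> smooth_section W (fun x => J x (s' x)).
    exact: smooth_section_endo.
  have sh s' : smooth_section W s' -> smooth_fun W (fun x => h x (s x) (s' x)).
    exact: smooth_metric.
  do 2!apply: smooth_section_add => //; apply: smooth_section_scale => //;
    try apply: smooth_fun_opp; auto.
have tx0 : t x0 = w.
  by rewrite /t sx0 para_proj_eq0 // subr0.
have shtt : smooth_fun W (fun x => h x (t x) (t x)) by exact: smooth_metric.
pose W' := [set x | W x /\ h x (t x) (t x) != 0].
have oW' : open W'.
  rewrite openE => x [Wx hx]; have ctt := smooth_fun_continuous oW shtt Wx.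
  have nhx : \forall y \near x, h y (t y) (t y) != 0.
    exact: (cvgr_neq0 _ ctt hx).
  move: (open_nbhs_nbhs (conj oW Wx : open_nbhs x W)) nhx.
  by rewrite /interior; apply: filterS2 => y Wy hy; split.
have W'W : W' `<=` W by move=> x [].
pose c x := (h x (t x) (t x))^-1.
have sc : smooth_fun W' c.
  apply: smooth_fun_inv => //; first by move=> x [].
  exact: smooth_fun_sub shtt.
pose q : section E := fun x =>
  ((1 + c x) / 2) *: t x + ((1 - c x) / 2) *: J x (t x).
have stW' := smooth_section_sub W'W st.
have smA (a b : R) : smooth_fun W' (fun x => (a + b * c x) / 2).
  apply: smooth_fun_mul => //; last exact: smooth_fun_cst.
  apply: smooth_fun_add => //; first exact: smooth_fun_cst.
  apply: smooth_fun_mul => //; exact: smooth_fun_cst.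
have sq : smooth_section W' q.
  apply: smooth_section_add => //; apply: smooth_section_scale => //.
  - by apply: smooth_fun_eq (smA 1 1) => // x _; rewrite mul1r.
  - by apply: smooth_fun_eq (smA 1 (-1)) => // x _; rewrite mulN1r.
  - exact: smooth_section_endo.
exists W', (fun i => if i == k then q else u i); split=> //.
- by split; rewrite ?tx0.
- by move=> i; case: (i == k) => //; apply: smooth_section_sub (suW i).
move=> x [Wx hx]; have [Ux _] := Wx.
have ot : para_ortho (h x) (I x) (J x) k (fun i => u i x) (t x).
  by apply: (para_proj_ortho (ph x)); exact: uu.
have := para_unitary_extend (ph x) (uu x Ux) (_ : para_ortho _ _ _ _ _ (q x)).
have oq : para_ortho (h x) (I x) (J x) k (fun i => u i x) (q x).
  apply: (para_orthoD (ph x)); first exact: (para_orthoZ (ph x)).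
  by apply: (para_orthoZ (ph x)); apply: (para_orthoJ (ph x)).
move/(_ oq (para_normalize (ph x) hx)) => uq i j ik jk.
by have := uq i j ik jk; case: (i == k); case: (j == k).
Qed.

(** I and J act through [LI] and [LJ] at every point of M, even outside U where
    the vectors of f need not form a basis; these relations can then be
    differentiated as equalities between global sections. *)
Lemma local_adapted_frame x0 :
  exists (U : set M) (f : frame_field E), [/\ open U, U x0,
    forall j, smooth_section U (fun x => tnth (f x) j),
    forall x, U x -> adapted_frame (h x) (I x) (J x) (f x) &
    forall x, map_tuple (I x) (f x) = frame_mul (f x) (LI n) /\
              map_tuple (J x) (f x) = frame_mul (f x) (LJ n)].
Proof.
have [U [u [oU Ux0 su uu]]] := local_para_unitary x0 (leqnn n).
exists U, (fun x => para_frame (I x) (J x) n (fun i => u i x)); split=> //.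
- have sI s : smooth_section U s -> smooth_section U (fun x => I x (s x)).
    exact: smooth_section_endo.
  have sJ s : smooth_section U s -> smooth_section U (fun x => J x (s x)).
    exact: smooth_section_endo.
  apply: ord4n_ind => i.
  + by apply: smooth_section_eq (su i) => // x _; rewrite para_frame1.
  + by apply: smooth_section_eq (sI _ (su i)) => // x _; rewrite para_frame2.
  + by apply: smooth_section_eq (sJ _ (su i)) => // x _; rewrite para_frame3.
  + by apply: smooth_section_eq (sI _ (sJ _ (su i))) => // x _;
      rewrite para_frame4.
- move=> x Ux; apply: adapted_para_frame => //; first exact: dim_fiber.
  exact: uu.
- by move=> x; split; [exact: (para_frame_I (ph x))|exact: (para_frame_J (ph x))].
Qed.

End LocalFrames.

(** * Orientation *)

Section Reflection.
Context {R : realType} (n : nat).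
Local Notation I' := (@I'4n R n).

Lemma In_eps_sqr eps : @In_eps R n eps *m In_eps n eps = 1%:M.
Proof.
rewrite /In_eps mulmx_diag -[RHS]diag_const_mx; congr diag_mx.
apply/rowP => i; rewrite !mxE; case: (val i == 0%N); rewrite ?mulr1 //.
by rewrite -expr2 sqrr_sign.
Qed.

Lemma I'4n_sqr eps : I' eps *m I' eps = 1%:M.
Proof.
rewrite /I'4n !mulmx_block !(mulmx0, mul0mx, mulmx1, mul1mx, addr0, add0r).
by rewrite In_eps_sqr -!scalar_mx_block.
Qed.

Lemma I'4n_neutral eps : (I' eps)^T *m neutral_mx n *m I' eps = neutral_mx n.
Proof.
rewrite /I'4n /neutral_mx !tr_block_mx !trmx1 !trmx0 tr_diag_mx.
rewrite (scalar_mx_block n n 1) opp_block_mx !oppr0.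
rewrite !(mulmx_block, mulmx0, mul0mx, mulmx1, mul1mx, addr0, add0r, mulmxN,
  mulNmx, oppr0).
by rewrite In_eps_sqr.
Qed.

Lemma I'4n_false : I' false = 1%:M.
Proof.
rewrite /I'4n (_ : In_eps n false = 1%:M) -?scalar_mx_block //.
rewrite /In_eps -[RHS]diag_const_mx; congr diag_mx.
by apply/rowP => i; rewrite !mxE; case: ifP.
Qed.

Lemma det_I'4n eps : (0 < n)%N -> \det (I' eps) = (-1) ^+ eps.
Proof.
move=> n_gt0; rewrite /I'4n !det_ublock !det1 !mul1r det_diag.
rewrite (bigD1 (Ordinal n_gt0)) //= mxE eqxx big1 ?mulr1 // => i i0.
rewrite mxE ifF //; apply: contraNF i0 => /eqP i0; apply/eqP; exact: val_inj.
Qed.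

Lemma unitmx_I'4n eps : I' eps \in unitmx.
Proof. by have /mulmx1_unit[] := I'4n_sqr eps. Qed.

End Reflection.

Section Orientation.
Context {R : realType} {m : nat} {M : manifold R m}.

Lemma pos_frame_mul k (E : bundle M k) (o : orientation E) x
    (f : k.-tuple (E x)) (A : 'M[R]_k) :
  basis_of fullv f -> \det A < 0 -> ~ pos o f -> pos o (frame_mul f A).
Proof.
move=> bf dA nf; have [U [g [_ Ux lg /(_ x Ux) pg]]] := pos_local o x.
have uA : A \in unitmx by rewrite unitmxE unitfE lt_eqF.
have bg := pos_basis pg; apply/(pos_change pg); first exact: basis_frame_mul.
rewrite -/(coord_mx _ _) coord_mx_frame_mul det_mulmx nmulr_lgt0 //.
rewrite lt_neqAle det_coord_mx_neq0 //= leNgt; apply/negP => df; apply: nf.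
exact/(pos_change pg).
Qed.

(** The orientation of a local frame is locally constant. *)
Lemma open_pos_frame k (E : bundle M k) (o : orientation E) (U : set M)
    (f : frame_field E) x : open U -> U x -> local_frame U f ->
  exists V : set M, [/\ open V, V x, V `<=` U &
    forall y, V y -> pos o (f y) <-> pos o (f x)].
Proof.
move=> oU Ux [bf sf]; have [U' [g [oU' U'x [bg sg] pg]]] := pos_local o x.
have [i dx] := triv_cover E x; have oi := @triv_dom_open _ _ _ _ E i.
pose W := (U `&` U') `&` triv_dom i.
have oW : open W by apply: openI => //; exact: openI.
(* F is positive where f and the positive frame g induce the same orientation. *)
pose F y := \det (coord_mx (triv_frame i y) (f y))
          * \det (coord_mx (triv_frame i y) (g y)).
have sF : smooth_fun W F.
  apply: smooth_fun_mul => //; apply: smooth_fun_det => // a b.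
  - apply: smooth_fun_eq (smooth_fun_sub _ (sf b i a)) => // [y _|].
      by rewrite mxE.
    by move=> y [[Uy _] iy].
  - apply: smooth_fun_eq (smooth_fun_sub _ (sg b i a)) => // [y _|].
      by rewrite mxE.
    by move=> y [[_ Uy] iy].
have posF y : W y -> pos o (f y) <-> 0 < F y.
  move=> [[Uy U'y] iy]; have py := pg y U'y.
  rewrite (pos_change py (bf y Uy)) -/(coord_mx _ _) /F.
  rewrite (coord_mx_trans (triv_frame i y) (f y) (bg y U'y)) det_mulmx mulrAC -expr2.
  rewrite pmulr_rgt0 // exprn_even_gt0 //=.
  by apply: det_coord_mx_neq0; [exact: triv_basis|exact: bg].
have Fn0 y : W y -> F y != 0.
  move=> [[Uy U'y] iy]; have bt := triv_basis iy.
  exact: mulf_neq0 (det_coord_mx_neq0 bt (bf y Uy))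
    (det_coord_mx_neq0 bt (bg y U'y)).
have Wx : W x by [].
have cF := smooth_fun_continuous oW sF Wx.
pose V := [set y | W y /\ 0 < F y * F x].
have F2 : smooth_fun W (fun y => F y * F x).
  by apply: smooth_fun_mul => //; exact: smooth_fun_cst.
exists V; split.
- rewrite openE => y [Wy Fy].
  have nF : \forall z \near y, 0 < F z * F x.
    exact: (cvgr_gt _ (smooth_fun_continuous oW F2 Wy) _ Fy).
  move: (open_nbhs_nbhs (conj oW Wy : open_nbhs y W)) nF.
  by rewrite /interior; apply: filterS2 => z Wz hz; split.
- by split=> //; rewrite -expr2 exprn_even_gt0 //= Fn0.
- by move=> y [[[]]].
- move=> y [Wy Fxy]; rewrite (posF y Wy) (posF x Wx).
  by split=> p; [rewrite -(pmulr_rgt0 _ p)|rewrite -(pmulr_lgt0 _ p)].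
Qed.

End Orientation.

Section Sign.
Context {R : realType} {m n : nat} {M : manifold R m}.
Context {E : bundle M (fourn n)} (h : neutral_metric E) (o : orientation E).
Variables (I J : endo_section E).
Hypotheses (smI : smooth_endo I) (smJ : smooth_endo J).
Hypothesis ph : forall x, para_hermitian (h x) (I x) (J x).
Local Notation adapted_at x := (adapted_frame (h x) (I x) (J x)).

Lemma adapted_frame_pos x (f f' : (fourn n).-tuple (E x)) :
  adapted_at x f -> adapted_at x f' -> pos o f -> pos o f'.
Proof.
move=> af af' pf; apply/(pos_change pf); first exact: af_basis af'.
by have [[_ ->] _] := adapted_frame_trans (ph x) af af'; exact: ltr01.
Qed.

(** Adapted frames at a point all have the same orientation, and this
    orientation is locally constant; on a connected manifold a single sign
    therefore corrects all of them. *)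
Lemma exists_orientation_sign : (0 < n)%N -> connected [set: M] ->
  exists eps, forall x (f : (fourn n).-tuple (E x)), adapted_at x f ->
    pos o (frame_mul f (I'4n n eps)).
Proof.
move=> n_gt0 cM.
pose S := [set x : M | exists2 f : (fourn n).-tuple (E x),
  adapted_at x f & pos o f].
have locS x : exists V : set M, [/\ open V, V x & forall y, V y -> S y <-> S x].
  have [U [f [oU Ux sf af _]]] := local_adapted_frame smI smJ ph x.
  have lf : local_frame U f by split=> // y Uy; exact: af_basis (af y Uy).
  have [V [oV Vx VU pV]] := open_pos_frame o oU Ux lf.
  have Sf y : U y -> S y <-> pos o (f y).
    move=> Uy; split=> [[g ag]|pf]; last by exists (f y) => //; exact: af.
    by apply: adapted_frame_pos => //; exact: af.
  by exists V; split=> // y Vy; rewrite (Sf y (VU y Vy)) (Sf x Ux); exact: pV.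
have openS (b : bool) : open [set x | S x <-> b].
  rewrite openE => x Sx; have [V [oV Vx SV]] := locS x.
  move: (open_nbhs_nbhs (conj oV Vx : open_nbhs x V)); rewrite /interior.
  by apply: filterS => y Vy /=; rewrite SV.
have oS : open S.
  by have := openS true; congr open; apply/seteqP; split=> x /=; rewrite /is_true; tauto.
have cS : closed S.
  rewrite -openC; have := openS false; congr open; apply/seteqP; split=> x /=.
    by case=> H _ /H.
  by move=> nS; split.
have [[x Sx]|nS] := pselect (S !=set0).
  exists false => y f af; rewrite I'4n_false frame_mul1.
  have ST : S = setT.
    by apply: cM; [exists x|exists S; rewrite ?setTI|exists S; rewrite ?setTI].
  have [g ag pg] : S y by rewrite ST.
  exact: adapted_frame_pos ag af pg.
exists true => x f af; apply: pos_frame_mul; first exact: af_basis af.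
  by rewrite det_I'4n // expr1 ltrN10.
by move=> pf; apply: nS; exists x, f.
Qed.

End Sign.

(** * Connections *)

Section Connections.
Context {R : realType} {m : nat} {M : manifold R m}.

Lemma smooth_fun_at_cst (x : M) (a : R) : smooth_fun_at x (fun=> a).
Proof. by exists setT; split=> //; [exact: openT|exact: smooth_fun_cst]. Qed.

Lemma tangent_cst (x : M) (v : tangent x) (a : R) : v (fun=> a) = 0.
Proof.
have s0 b := smooth_fun_at_cst x b.
have v0 : v (fun=> 0) = 0.
  have e : v (fun=> 0) = 1 * v (fun=> 0) + v (fun=> 0).
    rewrite -(tangent_linear v 1 (s0 0) (s0 0)).
    by congr (tangent_der v _); apply/funext => y; rewrite mulr0 addr0.
  by rewrite mul1r in e; apply: (addrI (v (fun=> 0))); rewrite -e addr0.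
have v1 : v (fun=> 1) = 0.
  have e : v (fun=> 1) = v (fun=> 1) * 1 + 1 * v (fun=> 1).
    rewrite -(tangent_leibniz v (s0 1) (s0 1)).
    by congr (tangent_der v _); apply/funext => y; rewrite mulr1.
  by rewrite mulr1 mul1r in e; apply: (addrI (v (fun=> 1))); rewrite -e addr0.
have := tangent_linear v a (s0 1) (s0 0); by rewrite v1 v0 !mulr0 mulr1 !addr0.
Qed.

(** With chi the indicator function of U, smooth near x, the Leibniz rule is
    applied to chi f = a chi. *)
Lemma tangent_locally_cst (x : M) (v : tangent x) (U : set M) (f : M -> R) a :
  open U -> U x -> (forall y, U y -> f y = a) -> v f = 0.
Proof.
move=> oU Ux fa; pose chi y : R := \1_U y.
have chi1 y : U y -> chi y = 1 by move=> Uy; rewrite /chi indicE mem_set.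
have chi0 y : ~ U y -> chi y = 0 by move=> Uy; rewrite /chi indicE memNset.
have sf : smooth_fun_at x f.
  exists U; split=> //; apply: smooth_fun_eq (smooth_fun_cst U a) => // y Uy.
  by rewrite fa.
have sc : smooth_fun_at x chi.
  exists U; split=> //; apply: smooth_fun_eq (smooth_fun_cst U 1) => // y Uy.
  by rewrite chi1.
have := tangent_leibniz v sc sf; rewrite chi1 // mul1r fa //.
have -> : (fun y => chi y * f y) = (fun y => a * chi y + 0).
  apply/funext => y; rewrite addr0 mulrC.
  by have [Uy|nUy] := pselect (U y); [rewrite fa|rewrite chi0 // !mulr0].
rewrite (tangent_linear v a sc (smooth_fun_at_cst x 0)) tangent_cst addr0.
by rewrite mulrC => e; apply: (addrI (v chi * a)); rewrite -e addr0.
Qed.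

Context {k : nat} {E : bundle M k} (D : connection E).

Lemma smooth_section_at_zero x : smooth_section_at x (fun y => 0 : E y).
Proof.
by exists setT; split=> //; [exact: openT|apply: smooth_section_zero; exact: openT].
Qed.

Lemma smooth_section_at_add x (s t : section E) : smooth_section_at x s ->
  smooth_section_at x t -> smooth_section_at x (fun y => s y + t y).
Proof.
case=> U [oU Ux sU] [V [oV Vx sV]]; have oW := openI oU oV.
exists (U `&` V); split=> //; apply: smooth_section_add => //.
  exact: smooth_section_sub sU.
exact: smooth_section_sub sV.
Qed.

Lemma smooth_section_at_scale x (a : R) (s : section E) :
  smooth_section_at x s -> smooth_section_at x (fun y => a *: s y).
Proof.
case=> U [oU Ux sU]; exists U; split=> //; apply: smooth_section_scale => //.
exact: smooth_fun_cst.
Qed.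

Lemma smooth_section_at_endo x (A : endo_section E) (s : section E) :
  smooth_endo A -> smooth_section_at x s ->
  smooth_section_at x (fun y => A y (s y)).
Proof.
by move=> sA [U [oU Ux sU]]; exists U; split=> //; exact: smooth_section_endo.
Qed.

Lemma nabla_scale x (v : tangent x) (a : R) (s : section E) :
  smooth_section_at x s -> D x v (fun y => a *: s y) = a *: D x v s.
Proof.
move=> ss; rewrite (nabla_leibniz D v (smooth_fun_at_cst x a) ss).
by rewrite tangent_cst scale0r add0r.
Qed.

Lemma nabla_zero x (v : tangent x) : D x v (fun y => 0) = 0.
Proof.
have := nabla_scale v 0 (smooth_section_at_zero x); rewrite scale0r => <-.
by congr (nabla D v _); apply: functional_extensionality_dep => y; rewrite scale0r.
Qed.

Lemma nabla_sum x (v : tangent x) (T : Type) (r : seq T) (s : T -> section E) :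
  (forall i, smooth_section_at x (s i)) ->
  smooth_section_at x (fun y => \sum_(i <- r) s i y) /\
  D x v (fun y => \sum_(i <- r) s i y) = \sum_(i <- r) D x v (s i).
Proof.
move=> ss; elim: r => [|i r [IHs IH]].
  have -> : (fun y => \sum_(i <- [::]) s i y) = (fun y => 0 : E y).
    by apply: functional_extensionality_dep => y; rewrite big_nil.
  by rewrite big_nil nabla_zero; split=> //; exact: smooth_section_at_zero.
have -> : (fun y => \sum_(i <- i :: r) s i y) =
    (fun y => s i y + \sum_(i <- r) s i y).
  by apply: functional_extensionality_dep => y; rewrite big_cons.
by rewrite big_cons nabla_add // IH; split=> //; exact: smooth_section_at_add.
Qed.

Lemma smooth_endo_lin (a b : R) (A B : endo_section E) :
  smooth_endo A -> smooth_endo B -> smooth_endo (fun x => a *: A x + b *: B x).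
Proof.
move=> sA sB i p q; have oi := @triv_dom_open _ _ _ _ E i.
have sc c := smooth_fun_cst (@triv_dom _ _ _ _ E i) c.
apply: smooth_fun_eq (smooth_fun_add oi (smooth_fun_mul oi (sc a) (sA i p q))
  (smooth_fun_mul oi (sc b) (sB i p q))) => // x _.
by rewrite add_lfunE !scale_lfunE linearD !linearZ.
Qed.

Lemma parallel_lin (a b : R) (A B : endo_section E) :
  smooth_endo A -> smooth_endo B -> parallel D A -> parallel D B ->
  parallel D (fun x => a *: A x + b *: B x).
Proof.
move=> sA sB pA pB x v s ss; rewrite /nabla_endo.
have -> : (fun y => (a *: A y + b *: B y) (s y)) =
    (fun y => a *: A y (s y) + b *: B y (s y)).
  by apply: functional_extensionality_dep => y; rewrite add_lfunE !scale_lfunE.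
have sAs := smooth_section_at_endo sA ss.
have sBs := smooth_section_at_endo sB ss.
rewrite nabla_add ?nabla_scale //; try exact: smooth_section_at_scale.
rewrite add_lfunE !scale_lfunE opprD addrACA -!scalerBr.
have /= := pA x v s ss; have /= := pB x v s ss; rewrite /nabla_endo => -> ->.
by rewrite !scaler0 addr0.
Qed.

(** The connection form commutes with the constant matrix of a parallel
    endomorphism. *)
Lemma connection_form_commute (A : endo_section E) (f : frame_field E)
    (L : 'M[R]_k) x (v : tangent x) :
  parallel D A -> (forall j, smooth_section_at x (fun y => tnth (f y) j)) ->
  (forall y, map_tuple (A y) (f y) = frame_mul (f y) L) ->
  basis_of fullv (f x) ->
  let omega := coord_mx (f x) [tuple D x v (fun y => tnth (f y) j) | j < k] in
  omega *m L = L *m omega.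
Proof.
move=> pA sf fA bf; set df := [tuple _ | _ < _] => omega.
have fo : frame_mul (f x) omega = df := frame_mul_coord df bf.
apply: (frame_mul_inj (basis_free bf)); rewrite -!frame_mulA fo.
rewrite -fA -map_frame_mul fo; apply: eq_from_tnth => j.
rewrite tnth_frame_mul tnth_map tnth_mktuple.
have /= := pA x v _ (sf j); rewrite /nabla_endo => /eqP.
rewrite subr_eq0 => /eqP <-.
have -> : (fun y => A y (tnth (f y) j)) = (fun y => \sum_i L i j *: tnth (f y) i).
  apply: functional_extensionality_dep => y.
  by rewrite -tnth_frame_mul -fA tnth_map.
have [_ ->] := nabla_sum v (index_enum 'I_k)
  (fun i => smooth_section_at_scale (L i j) (sf i)).
by apply: eq_bigr => i _; rewrite nabla_scale // tnth_mktuple.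
Qed.

End Connections.

Section MetricConnection.
Context {R : realType} {m n : nat} {M : manifold R m}.
Context {E : bundle M (fourn n)} (h : neutral_metric E) (D : connection E).
Variables (I J : endo_section E).
Hypothesis ph : forall x, para_hermitian (h x) (I x) (J x).

Lemma connection_form_skew (U : set M) (f : frame_field E) x (v : tangent x) :
  metric_connection h D -> open U -> U x ->
  (forall j, smooth_section U (fun y => tnth (f y) j)) ->
  (forall y, U y -> adapted_frame (h y) (I y) (J y) (f y)) ->
  let omega :=
    coord_mx (f x) [tuple D x v (fun y => tnth (f y) j) | j < fourn n] in
  omega^T *m neutral_mx n + neutral_mx n *m omega = 0.
Proof.
move=> hD oU Ux sf af; set df := [tuple _ | _ < _] => omega.
have bf := af_basis (af x Ux); have gf := af_gram (af x Ux).
have fo : frame_mul (f x) omega = df := frame_mul_coord df bf.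
have sfx j : smooth_section_at x (fun y => tnth (f y) j) by exists U.
apply/matrixP => a b; rewrite mxE [RHS]mxE.
have := ph_gram (ph x) omega 1%:M a b gf; rewrite mulmx1 frame_mul1 fo => <-.
have := ph_gram (ph x) 1%:M omega a b gf.
rewrite trmx1 mul1mx frame_mul1 fo => <-; rewrite !tnth_mktuple -hD //.
by apply: (tangent_locally_cst v oU Ux) => y Uy; exact: af_gram (af y Uy) a b.
Qed.

End MetricConnection.

(** * Nilpotent structures from paraquaternionic structures *)

Section Paraquaternions.
Context {R : realType} {V : vectType R}.
Variables (I J : 'End(V)).
Hypotheses (II : forall u, I (I u) = - u) (JJ : forall u, J (J u) = u).
Hypothesis JI : forall u, J (I u) = - I (J u).

(** The action of the paraquaternion p + q I + r J + t I J. *)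
Definition pquat (p q r t : R) (u : V) : V :=
  p *: u + q *: I u + r *: J u + t *: I (J u).

Lemma pquatM p q r t p' q' r' t' u :
  pquat p q r t (pquat p' q' r' t' u) =
  pquat (p * p' - q * q' + r * r' + t * t') (p * q' + q * p' - r * t' + t * r')
        (p * r' + r * p' - q * t' + t * q') (p * t' + t * p' + q * r' - r * q') u.
Proof.
rewrite /pquat !(endoD, endoZ) !(JI, endoN, II, JJ).
by apply: coord_vbasis_inj => i; rewrite !(coordD, coordZ, coordN); ring.
Qed.

End Paraquaternions.

Section Reduction.
Context {R : realType} {V : vectType R} (h : V -> V -> R).
Variables (I J : 'End(V)).
Hypothesis ph : para_hermitian h I J.

(** J' is obtained from J by a rotation in the plane of J and I J, and I' from I
    by a hyperbolic rotation in the plane of I and I J'. *)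
Lemma para_hermitian_change (I' J' : 'End(V)) (a b c s : R) :
  a ^+ 2 - b ^+ 2 = 1 -> c ^+ 2 + s ^+ 2 = 1 ->
  (forall u, I' u = pquat I J 0 a (- (b * s)) (b * c) u) ->
  (forall u, J' u = pquat I J 0 0 c s u) ->
  para_hermitian h I' J' /\
  forall u, I' (J' u) = pquat I J 0 b (- (a * s)) (a * c) u.
Proof.
move=> ab cs I'E J'E.
have bcs : b * b * (c * c + s * s) = b * b by rewrite -!expr2 cs mulr1.
have acs : a * (c * c + s * s) = a by rewrite -!expr2 cs mulr1.
have bcs' : b * (c * c + s * s) = b by rewrite -!expr2 cs mulr1.
have QM := pquatM (ph_II ph) (ph_JJ ph) (ph_JI ph).
have skew q r t u v : h (pquat I J 0 q r t u) v = - h u (pquat I J 0 q r t v).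
  rewrite /pquat !(ph_D ph, ph_Dr ph, ph_Z ph, ph_Zr ph) !(ph_norm ph) /=; ring.
rewrite !expr2 in ab cs.
split; last first.
  by move=> u; rewrite J'E I'E QM; congr pquat; lra.
split.
- exact: ph_linear ph.
- exact: ph_sym ph.
- exact: ph_nondeg ph.
- move=> u; rewrite !I'E QM; transitivity (pquat I J (-1) 0 0 0 u).
    by congr pquat; lra.
  by rewrite /pquat !scale0r !addr0 scaleN1r.
- move=> u; rewrite !J'E QM; transitivity (pquat I J 1 0 0 0 u).
    by congr pquat; lra.
  by rewrite /pquat !scale0r !addr0 scale1r.
- move=> u; rewrite (I'E u) (J'E u) J'E I'E !QM.
  transitivity (pquat I J 0 (- b) (a * s) (- (a * c)) u).
    by congr pquat; lra.
  transitivity (- pquat I J 0 b (- (a * s)) (a * c) u).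
    rewrite /pquat; apply: coord_vbasis_inj => i.
    by rewrite !(coordD, coordZ, coordN); ring.
  by congr (- pquat _ _ _ _ _ _ _); lra.
- by move=> u v; rewrite !I'E skew.
- by move=> u v; rewrite !J'E skew.
Qed.

End Reduction.

Section Nilpotent.
Context {R : realType} {m n : nat} {M : manifold R m}.
Context {E : bundle M (fourn n)} (o : orientation E) (h : neutral_metric E).
Variables (I J N : endo_section E).
Hypotheses (n_gt0 : (0 < n)%N) (cM : connected [set: M]).
Hypotheses (smI : smooth_endo I) (smJ : smooth_endo J) (smN : smooth_endo N).
Hypothesis ph : forall x, para_hermitian (h x) (I x) (J x).
Hypothesis NE : forall x, N x = I x + (I x \o J x)%VF.

(** The frame f of the statement is the twist by I' of an admissible one, since
    I' is an involution; eps makes the latter positive. *)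
Lemma admissible_of_adapted eps (U : set M) (f : frame_field E) :
  open U ->
  (forall x (f : (fourn n).-tuple (E x)), adapted_frame (h x) (I x) (J x) f ->
    pos o (frame_mul f (I'4n n eps))) ->
  (forall j, smooth_section U (fun x => tnth (f x) j)) ->
  (forall x, U x -> adapted_frame (h x) (I x) (J x) (f x)) ->
  admissible o h eps N U (fun x => frame_mul (f x) (I'4n n eps)).
Proof.
move=> oU po sf af; split.
- split; first split.
  + move=> x Ux; apply: basis_frame_mul; first exact: af_basis (af x Ux).
    exact: unitmx_I'4n.
  + move=> j; apply: smooth_section_eq (smooth_section_sum (index_enum _) oU
      (fun i => smooth_section_scale oU (smooth_fun_cst U (I'4n n eps i j)) (sf i)))
      => // x _.
    by rewrite tnth_frame_mul.
  + move=> x Ux a b; rewrite (ph_gram (ph x) _ _ _ _ (af_gram (af x Ux))).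
    by rewrite I'4n_neutral.
- by move=> x Ux; apply: po; exact: af.
- move=> x Ux; rewrite /twist frame_mulA I'4n_sqr frame_mul1 NE.
  exact: (adapted_frame_Lambda (af x Ux)).
Qed.

(** The case of a structure of the form I + I J: adapted frames are admissible
    up to a twist, their transition matrices lie in H, and for a connection
    that makes h, I and J parallel so do the values of the connection form in
    its Lie algebra. *)
Lemma H_nilpotent_family : exists eps, eps_nilpotent o h eps N /\
  exists (U : M -> set M) (e : M -> frame_field E),
  K_family o h (H_group n) eps N U e /\
  forall (D : connection E), metric_connection h D ->
    parallel D I -> parallel D J -> forall l, exists omega,
      is_connection_form D (U l) (twist eps (e l)) omega /\
      forall (x : M) (v : tangent x), U l x -> lie_algebra (H_group n) (omega x v).
Proof.
have [eps po] := exists_orientation_sign o smI smJ ph n_gt0 cM.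
have /choice[p pP] : forall x, exists p : set M * frame_field E,
    [/\ open p.1, p.1 x,
      forall j, smooth_section p.1 (fun x => tnth (p.2 x) j),
      forall x, p.1 x -> adapted_frame (h x) (I x) (J x) (p.2 x) &
      forall x, map_tuple (I x) (p.2 x) = frame_mul (p.2 x) (LI n) /\
              map_tuple (J x) (p.2 x) = frame_mul (p.2 x) (LJ n)].
  by move=> x; have [U [f ?]] := local_adapted_frame smI smJ ph x; exists (U, f).
have adm x : admissible o h eps N (p x).1
    (fun y => frame_mul ((p x).2 y) (I'4n n eps)).
  by have [oU _ sf af _] := pP x; exact: admissible_of_adapted.
have tw x : twist eps (fun y => frame_mul ((p x).2 y) (I'4n n eps)) = (p x).2.
  apply: functional_extensionality_dep => y.
  by rewrite /twist frame_mulA I'4n_sqr frame_mul1.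
exists eps; split.
  split=> // x; exists (p x).1, (fun y => frame_mul ((p x).2 y) (I'4n n eps)).
  by have [oU Ux _ _ _] := pP x; split.
exists (fun x => (p x).1), (fun x y => frame_mul ((p x).2 y) (I'4n n eps)).
split.
  split=> //.
  - by move=> x; have [] := pP x.
  - by move=> x; exists x; have [] := pP x.
  - move=> l l'; exists (fun x => coord_mx ((p l).2 x) ((p l').2 x)) => x Ux U'x.
    have [_ _ _ af _] := pP l; have [_ _ _ af' _] := pP l'.
    rewrite !tw frame_mul_coord; last exact: af_basis (af x Ux).
    by split=> //; exact: (adapted_frame_trans (ph x) (af x Ux) (af' x U'x)).
move=> D hD pI pJ l; rewrite tw; have [oU _ sf af fIJ] := pP l.
exists (fun x v => coord_mx ((p l).2 x)
  [tuple D x v (fun y => tnth ((p l).2 y) j) | j < fourn n]); split.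
  by move=> x v Ux; rewrite frame_mul_coord //; exact: af_basis (af x Ux).
move=> x v Ux; have bf := af_basis (af x Ux).
have sfx j : smooth_section_at x (fun y => tnth ((p l).2 y) j).
  by exists (p l).1.
apply: lie_algebra_H.
- exact: (connection_form_skew ph v hD oU Ux sf af).
- exact: (connection_form_commute v pI sfx (fun y => (fIJ y).1) bf).
- exact: (connection_form_commute v pJ sfx (fun y => (fIJ y).2) bf).
Qed.

End Nilpotent.

Theorem theorem4p4 (R : realType) (m n : nat) (n_gt0 : (0 < n)%N)
  (M : manifold R m) (M_connected : connected [set: M])
  (E : bundle M (fourn n)) (o : orientation E) (h : neutral_metric E)
  (D : connection E) (D_metric : metric_connection h D)
  (I J1 J2 : endo_section E)
  (I_cplx : is_complex_structure I)
  (J1_pcplx : is_paracomplex_structure J1)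
  (J2_pcplx : is_paracomplex_structure J2)
  (IJ_pquat : is_paraquaternionic I J1 J2)
  (h_adapted : adapted h I J1 J2) :
  let N (r theta : R) : endo_section E := fun x =>
    r *: (I x - sin theta *: J1 x + cos theta *: J2 x) in
  (forall r theta : R, r != 0 -> 0 <= theta < 2 * pi ->
     K_nilpotent o h (H_group n) (N r theta)) /\
  (neutral_hyperkahler h D I J1 J2 ->
   forall r theta : R, r != 0 -> 0 <= theta < 2 * pi ->
     K_nilpotent_connection o h (H_group n) D (N r theta)).
Proof.
move=> N.
have [smI I2] := I_cplx; have [smJ1 J12] := J1_pcplx; have [smJ2 J22] := J2_pcplx.
have [hI hJ1 hJ2] := h_adapted.
have IIu x u : I x (I x u) = - u.
  by have := congr1 (fun F : 'End(E x) => F u) (I2 x);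
    rewrite comp_lfunE opp_lfunE id_lfunE.
have J1J1u x u : J1 x (J1 x u) = u.
  by have := congr1 (fun F : 'End(E x) => F u) (J12 x).1;
    rewrite comp_lfunE id_lfunE.
have J2u x u : J2 x u = I x (J1 x u).
  by have := congr1 (fun F : 'End(E x) => F u) (IJ_pquat x).1;
    rewrite comp_lfunE => <-.
have J1Iu x u : J1 x (I x u) = - I x (J1 x u).
  have := congr1 (fun F : 'End(E x) => F (J1 x u)) (J22 x).1.
  rewrite comp_lfunE id_lfunE !J2u J1J1u => /(congr1 (I x)).
  by rewrite IIu => <-; rewrite opprK.
have ph x : para_hermitian (h x) (I x) (J1 x).
  split=> //.
  - exact: metric_linear.
  - exact: Defs.metric_sym.
  - exact: metric_nondeg.
  - by move=> u v; rewrite -[v in LHS]opprK metricNr -(IIu x v) hI.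
  - by move=> u v; rewrite -hJ1 J1J1u.
(* a r + b r = r and a r ^ 2 - b r ^ 2 = 1 *)
pose a (r : R) := (r + r^-1) / 2; pose b (r : R) := (r - r^-1) / 2.
pose I' (r theta : R) : endo_section E := fun x =>
  1 *: (a r *: I x + (- (b r * sin theta)) *: J1 x)
  + (b r * cos theta) *: J2 x.
pose J' (theta : R) : endo_section E := fun x =>
  cos theta *: J1 x + sin theta *: J2 x.
have smI' r theta : smooth_endo (I' r theta).
  by apply: smooth_endo_lin => //; exact: smooth_endo_lin.
have smJ' theta : smooth_endo (J' theta) by exact: smooth_endo_lin.
have smN r theta : smooth_endo (N r theta).
  have -> : N r theta = (fun x => r *: (1 *: I x + (- sin theta) *: J1 x)
     + (r * cos theta) *: J2 x).
    apply: functional_extensionality_dep => x.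
    by rewrite /N scalerDr scalerA scale1r scaleNr.
  by apply: smooth_endo_lin => //; exact: smooth_endo_lin.
have I'E r theta x u : I' r theta x u =
    pquat (I x) (J1 x) 0 (a r) (- (b r * sin theta)) (b r * cos theta) u.
  by rewrite /I' !add_lfunE !scale_lfunE add_lfunE !scale_lfunE J2u /pquat
    scale0r add0r scale1r.
have J'E theta x u : J' theta x u =
    pquat (I x) (J1 x) 0 0 (cos theta) (sin theta) u.
  by rewrite /J' add_lfunE !scale_lfunE J2u /pquat !scale0r !add0r.
have ab r : r != 0 -> a r ^+ 2 - b r ^+ 2 = 1.
  by move=> r0; rewrite /a /b; field.
have change r theta x (r0 : r != 0) := para_hermitian_change (ph x) (ab r r0)
  (cos2Dsin2 theta) (I'E r theta x) (J'E theta x).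
have NE r theta : r != 0 -> forall x,
    N r theta x = I' r theta x + (I' r theta x \o J' theta x)%VF.
  move=> r0 x; apply/lfunP => u; rewrite add_lfunE comp_lfunE.
  have [_ ->] := change r theta x r0; rewrite I'E /N.
  rewrite scale_lfunE !add_lfunE opp_lfunE !scale_lfunE J2u /pquat.
  apply: coord_vbasis_inj => i; rewrite !(coordD, coordZ, coordN) /a /b.
  by field.
have fam r theta (r0 : r != 0) := H_nilpotent_family o n_gt0 M_connected
  (smI' r theta) (smJ' theta) (smN r theta)
  (fun x => (change r theta x r0).1) (NE r theta r0).
split=> [r theta r0 _|[_ _ pI pJ1 pJ2] r theta r0 _].
  have [eps [nN [U [e [fe _]]]]] := fam r theta r0.
  by exists eps; split=> //; exists M, U, e.
have [eps [nN [U [e [fe oe]]]]] := fam r theta r0.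
exists eps; split=> //; exists M, U, e; split=> //; apply: oe => //.
  by apply: parallel_lin => //; [exact: smooth_endo_lin|exact: parallel_lin].
exact: parallel_lin.
Qed.
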